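(* Consider the variational problem $(\mathcal I,\omega^1;\varphi)$ on the indicatrix bundle $\Sigma$ of a Finsler surface $(M,F)$, where $\mathcal I=\{\omega^2\}$ and $\varphi=\omega^1$. Let $\hat\gamma^\perp$ be the normal lift to $\Sigma$ of a smooth curve $\gamma$ on $M$. Then: (1) the Euler-Lagrange differential system of this variational problem is, along $\hat\gamma^\perp$, $$(dI+\omega^3)|_{\hat\gamma^\perp}=0,$$ i.e. the one-form $dI+\omega^3$ pulls back to zero along $\hat\gamma^\perp$; (2) the corresponding Euler-Lagrange equation is $$(I_3\circ\hat\gamma^\perp+1)\,k_T^{(N)}=(I_1\circ\hat\gamma^\perp)\,\sigma^2 .$$
   Context: Finsler surface: $M$ is a smooth (oriented) surface and $F:TM\to[0,\infty)$ is smooth on $TM\setminus\{0\}$ and restricts to a Minkowski norm on each $T_xM$; $g_{ij}(x,y)=\frac12\frac{\partial^2F^2}{\partial y^i\partial y^j}$, and for $0\neq N\in T_xM$, $g_N(U,V)=g_{ij}(x,N)U^iV^j$. $\Sigma=\{F=1\}\subset TM$ is the indicatrix bundle, a 3-manifold. It carries the coframe $\omega^1,\omega^2,\omega^3$, where $\omega^1=\frac{\sqrt{g}}{F}(y^2dx^1-y^1dx^2)$ (with $g=\det(g_{ij})$), $\omega^2=\frac{\partial F}{\partial y^1}dx^1+\frac{\partial F}{\partial y^2}dx^2$, and $\omega^3$ is determined by the structure equations $d\omega^1=-I\omega^1\wedge\omega^3+\omega^2\wedge\omega^3$, $d\omega^2=-\omega^1\wedge\omega^3$, $d\omega^3=K\omega^1\wedge\omega^2-J\omega^1\wedge\omega^3$,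 with $I$ (the Cartan scalar), $J$, $K$ smooth functions on $\Sigma$. For a function $f$ on $\Sigma$, $f_1,f_2,f_3$ are defined by $df=f_1\omega^1+f_2\omega^2+f_3\omega^3$. Normal lift: for a smooth curve $\gamma$ on $M$ with tangent $T=\dot\gamma$, parameterized so that $F(\gamma,\dot\gamma)=1$, let $N$ be the normal field along $\gamma$ with $g_N(N,N)=1$, $g_N(N,T)=0$. The normal lift is $\hat\gamma^\perp(t)=(\gamma(t),N(t))\in\Sigma$. Put $\sigma=\omega^1(\dot{\hat\gamma}^\perp)$, so that $\sigma^2=g_N(T,T)$. With $(D_T^{(N)}U)^i=\frac{dU^i}{dt}+T^jU^k\Gamma^i_{jk}(\gamma,N)$, $\Gamma^i_{jk}$ the Chern connection coefficients, the $N$-parallel curvature $k_T^{(N)}$ is defined by $D_T^{(N)}N=-\frac{k_T^{(N)}}{\sigma^2}T$. One has $\hat\gamma^{\perp*}\omega^1=\sigma\,dt$, $\hat\gamma^{\perp*}\omega^2=0$, $\hat\gamma^{\perp*}\omega^3=-\frac{k_T^{(N)}}{\sigma}dt$. Variational problem: it concerns the functional $\Phi(\hat\gamma)=\int_{\hat\gamma}\omega^1$ on integral curves $\hat\gamma$ of the Pfaffian system $\mathcal I=\{\omega^2\}$ with independence condition $\omega^1$ (i.e. $\hat\gamma^*\omega^2=0$, $\hat\gamma^*\omega^1\ne0$). Euler-Lagrange system (Griffiths): on $Z=\Sigma\times\mathbb R$ with coordinate $\lambda$ on $\mathbb R$, put $\psi=\omega^1+\lambda\omega^2$, $\Psi=d\psi$,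 and let the Cartan system $\mathcal C(\Psi)$ be generated by all one-forms $v\lrcorner\Psi$, $v$ a vector field on $Z$. Let $Z_1\subset Z$ be the set of points admitting a tangent line annihilated by $\mathcal C(\Psi)$ on which $\omega^1\neq0$; $Z_2\subset Z_1$ the set of points admitting such a line tangent to $Z_1$; and so on, until the process stabilizes at $Y\subset Z$. The Euler-Lagrange system is the Pfaffian system $(\mathcal C(\Psi)|_Y,\omega^1)$ on $Y$; a curve in $\Sigma$ satisfies it if it is the projection of an integral curve of this system. The Euler-Lagrange equation is the expression of this condition for $\hat\gamma^\perp$ in terms of $\sigma$ and $k_T^{(N)}$. *)

(* Defs.v *)
From HB Require Import structures.
From mathcomp Require Import all_boot all_order all_algebra.
From mathcomp Require Import all_classical all_reals all_analysis.

Set Implicit Arguments.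
Unset Strict Implicit.
Unset Printing Implicit Defensive.

Import Order.TTheory GRing.Theory Num.Theory.
Import numFieldNormedType.Exports.

Local Open Scope classical_set_scope.
Local Open Scope ring_scope.

(** * Smooth maps on open subsets of finite-dimensional normed spaces *)

Fixpoint Ck_on (R : realType) (E G : normedModType R) (k : nat) (U : set E)
    (f : E -> G) : Prop :=
  match k with
  | 0 => forall x, U x -> {for x, continuous f}
  | k'.+1 => (forall x, U x -> differentiable f x) /\
             (forall v : E, Ck_on k' U (fun x => 'D_v f x))
  end.

Definition smooth_on (R : realType) (E G : normedModType R) (U : set E)
    (f : E -> G) : Prop := forall k, Ck_on k U f.

(** * Charted spaces

    A tangent vector at [p] is represented by its components in the preferred
    chart [chart_at p]; thus every tangent space is a copy of the model [E].
    [unchart a] is only meaningful on the image of the chart [a]. *)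

Record charts (R : realType) (E : normedModType R) (X : Type) := Charts {
  chart_index : Type;
  chart_dom : chart_index -> set X;
  chart_map : chart_index -> X -> E;
  unchart : chart_index -> E -> X;
  chart_at : X -> chart_index
}.

Section Charted.
Context {R : realType} {E : normedModType R} {X : Type} (A : charts E X).
Implicit Types (a b : chart_index A) (p : X) (U : set X).

Definition chart_image a U : set E := chart_map a @` (chart_dom a `&` U).

Definition transition a b : E -> E := chart_map b \o unchart a.

(* components in the chart [a] of the tangent vector [v] at [p] *)
Definition vec_coord a p (v : E) : E :=
  'D_v (transition (chart_at A p) a) (chart_map (chart_at A p) p).

(* the tangent vector at [unchart a x] whose components in [a] are [w] *)
Definition vec_unchart a (x w : E) : E :=
  'D_w (transition a (chart_at A (unchart a x))) x.

Definition smooth_fun U (f : X -> R) : Prop :=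
  forall a, smooth_on (chart_image a U) (f \o unchart a : E -> R^o).

Definition dfun (f : X -> R) p (v : E) : R :=
  'D_v (f \o unchart (chart_at A p) : E -> R^o) (chart_map (chart_at A p) p).

Definition local_form (w : X -> E -> R) a (x v : E) : R :=
  w (unchart a x) (vec_unchart a x v).

Definition smooth_form U (w : X -> E -> R) : Prop :=
  (forall p, U p -> linear (w p : E -> R^o)) /\
  (forall a v, smooth_on (chart_image a U)
                 ((fun x => local_form w a x v) : E -> R^o)).

(* normalised by d(f dg)(u, v) = df(u) dg(v) - df(v) dg(u) *)
Definition dform (w : X -> E -> R) p (u v : E) : R :=
  let a := chart_at A p in
  'D_u ((fun x => local_form w a x v) : E -> R^o) (chart_map a p)
  - 'D_v ((fun x => local_form w a x u) : E -> R^o) (chart_map a p).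

Definition smooth_curve (D : set R) (c : R -> X) : Prop :=
  forall a, let D' := D `&` c @^-1` chart_dom a in
    open D' /\ smooth_on (D' : set R^o) (chart_map a \o c : R^o -> E).

Definition velocity (c : R -> X) (t : R) : E :=
  derive1 (chart_map (chart_at A (c t)) \o c) t.

(* tangency to a subset that need not be a submanifold *)
Definition tangent_to (S : set X) p (v : E) : Prop :=
  exists e : R, exists c : R -> X,
    [/\ 0 < e, smooth_curve `]- e, e[ c, `]- e, e[ `<=` c @^-1` S,
        c 0 = p & velocity c 0 = v].

End Charted.

Definition wedge11 (R : realType) (E : Type) (al be : E -> R) (u v : E) : R :=
  al u * be v - al v * be u.

(* The total space of the tangent bundle; its topology is the one given by the
   charts below, not the product topology. *)
Definition tangent_charts (R : realType) (E : normedModType R) (X : Type)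
    (A : charts E X) : charts (E * E)%type (X * E) :=
  @Charts R (E * E)%type (X * E) (chart_index A)
    (fun a => [set xi | chart_dom a xi.1])
    (fun a xi => (chart_map a xi.1, vec_coord a xi.1 xi.2))
    (fun a z => (unchart a z.1, vec_unchart a z.1 z.2))
    (fun xi => chart_at A xi.1).

Definition line_charts (R : realType) (E : normedModType R) (X : Type)
    (A : charts E X) : charts (E * R^o)%type (X * R) :=
  @Charts R (E * R^o)%type (X * R) (chart_index A)
    (fun a z => chart_dom a z.1)
    (fun a z => (chart_map a z.1, z.2))
    (fun a z => (unchart a z.1, z.2))
    (fun z => chart_at A z.1).

Definition smooth_atlas (R : realType) (E : normedModType R)
    (M : topologicalType) (A : charts E M) : Prop :=
  [/\ (forall p, chart_dom (chart_at A p) p),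
      (forall a : chart_index A,
         open (chart_dom a) /\ open (chart_map a @` chart_dom a)),
      (forall (a : chart_index A) p, chart_dom a p ->
         unchart a (chart_map a p) = p),
      (forall (a : chart_index A) p, chart_dom a p ->
         {for p, continuous (chart_map a)} /\
         {for chart_map a p, continuous (unchart a)}) &
      (forall a b : chart_index A,
         smooth_on (chart_image a (chart_dom b)) (transition a b))].

Definition oriented_surface (R : realType) (M : topologicalType)
    (A : charts 'rV[R]_2 M) : Prop :=
  [/\ hausdorff_space M, second_countable (T := M), smooth_atlas A &
      forall (a b : chart_index A) p, chart_dom a p -> chart_dom b p ->
        0 < \det (jacobian (transition a b) (chart_map a p))].

(** * Finsler surfaces

    The upper indices 1, 2 of the coordinates are [0, 1 : 'I_2]. *)

Section Finsler.
Context {R : realType} {M : Type} (A : charts 'rV[R]_2 M).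
Notation E := 'rV[R]_2.
Notation TM := (M * E)%type.
Notation TA := (tangent_charts A).
Context (F : TM -> R).
Implicit Types (a : chart_index A) (z : E * E) (xi : TM) (i j k s : 'I_2).

Definition slit : set TM := [set xi | xi.2 != 0].

Definition loc_F a z : R := F (unchart (c := TA) a z).

Definition evec i : E := delta_mx 0 i.
Definition dx i (f : E * E -> R) z : R := 'D_((evec i, 0)) (f : E * E -> R^o) z.
Definition dy i (f : E * E -> R) z : R := 'D_((0, evec i)) (f : E * E -> R^o) z.

Definition g a z i j : R := 2^-1 * dy i (dy j (fun z' => loc_F a z' ^+ 2)) z.
Definition g_mx a z : 'M[R]_2 := \matrix_(i, j) g a z i j.
Definition g_inv a z i j : R := invmx (g_mx a z) i j.

(* g_N(U, V) for the tangent vectors N, U, V at p *)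
Definition g_inner p (N U V : E) : R :=
  let a := chart_at A p in
  \sum_i \sum_j g a (chart_map (c := TA) a (p, N)) i j * U 0 i * V 0 j.

Definition finsler_metric : Prop :=
  [/\ (forall xi, 0 <= F xi),
      smooth_fun TA slit F,
      (forall p (y : E) (r : R), 0 < r -> F (p, r *: y) = r * F (p, y)) &
      (forall p (y U : E), y != 0 -> U != 0 -> 0 < g_inner p y U U)].

(** ** The Chern connection in a chart

    Formal Christoffel symbols of [g], Cartan tensor [C^i_jk], nonlinear
    connection [N^i_j = gamma^i_jk y^k - C^i_jk gamma^k_rs y^r y^s], and the
    Christoffel formula with [d/dx^k] replaced by [d/dx^k - N^i_k d/dy^i]. *)

Definition christoffel a z i j k : R :=
  2^-1 * \sum_s g_inv a z i s *
    (dx k (fun z' => g a z' s j) z - dx s (fun z' => g a z' j k) z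
     + dx j (fun z' => g a z' k s) z).

Definition cartan_tensor a z i j k : R :=
  2^-1 * \sum_s g_inv a z i s * dy s (fun z' => g a z' j k) z.

Definition nonlinear_connection a z i j : R :=
  \sum_k christoffel a z i j k * z.2 0 k
  - \sum_k \sum_r \sum_s
      cartan_tensor a z i j k * christoffel a z k r s * z.2 0 r * z.2 0 s.

Definition delta_x a k (f : E * E -> R) z : R :=
  dx k f z - \sum_i nonlinear_connection a z i k * dy i f z.

Definition chern a z i j k : R :=
  2^-1 * \sum_s g_inv a z i s *
    (delta_x a k (fun z' => g a z' s j) z - delta_x a s (fun z' => g a z' j k) z
     + delta_x a j (fun z' => g a z' k s) z).

(* D_T^{(N)} U along c, for fields N and U along c and T the velocity of c *)
Definition cov_deriv (c : R -> M) (N U : R -> E) (t : R) : E :=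
  let a := chart_at A (c t) in
  let z := chart_map (c := TA) a (c t, N t) in
  \row_i (derive1 (fun r => vec_coord a (c r) (U r) 0 i) t
          + \sum_j \sum_k velocity A c t 0 j * U t 0 k * chern a z i j k).

(** ** The indicatrix bundle

    A function or form on the indicatrix bundle [Sigma] is given by one on the
    slit tangent bundle, of which only the values at points of [Sigma] on
    vectors tangent to [Sigma] are used. Every smooth form on [Sigma] is such a
    restriction (pull back by the radial retraction), and the exterior
    derivative commutes with restriction. *)

Definition Sigma : set TM := [set xi | F xi = 1].

Definition tangent_Sigma xi (u : E * E) : Prop := dfun TA F xi u = 0.

Definition omega1 xi (u : E * E) : R :=
  let a := chart_at A xi.1 in
  let z := chart_map (c := TA) a xi in
  Num.sqrt (\det (g_mx a z)) / F xi * (z.2 0 1 * u.1 0 0 - z.2 0 0 * u.1 0 1).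

Definition omega2 xi (u : E * E) : R :=
  let a := chart_at A xi.1 in
  let z := chart_map (c := TA) a xi in
  \sum_i dy i (loc_F a) z * u.1 0 i.

Definition structure_equations (omega3 : TM -> E * E -> R)
    (cI cJ cK : TM -> R) : Prop :=
  [/\ smooth_form TA slit omega3,
      [/\ smooth_fun TA slit cI, smooth_fun TA slit cJ & smooth_fun TA slit cK],
      (forall xi u, Sigma xi -> tangent_Sigma xi u ->
         omega1 xi u = 0 -> omega2 xi u = 0 -> omega3 xi u = 0 -> u = 0) &
      forall xi u v, Sigma xi -> tangent_Sigma xi u -> tangent_Sigma xi v ->
        [/\ dform TA omega1 xi u v
              = - cI xi * wedge11 (omega1 xi) (omega3 xi) u v
                + wedge11 (omega2 xi) (omega3 xi) u v,
            dform TA omega2 xi u v = - wedge11 (omega1 xi) (omega3 xi) u v &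
            dform TA omega3 xi u v
              = cK xi * wedge11 (omega1 xi) (omega2 xi) u v
                - cJ xi * wedge11 (omega1 xi) (omega3 xi) u v]].

(* df = f1 omega1 + f2 omega2 + f3 omega3 on Sigma *)
Definition coframe_derivatives (omega3 : TM -> E * E -> R)
    (f f1 f2 f3 : TM -> R) : Prop :=
  forall xi u, Sigma xi -> tangent_Sigma xi u ->
    dfun TA f xi u
    = f1 xi * omega1 xi u + f2 xi * omega2 xi u + f3 xi * omega3 xi u.

(** ** Normal lift and parallel curvature *)

Definition field_lift (c : R -> M) (N : R -> E) (t : R) : TM := (c t, N t).

Definition normal_lift (D : set R) (c : R -> M) (N : R -> E) : Prop :=
  [/\ smooth_curve A D c,
      (forall t, D t -> F (c t, velocity A c t) = 1),
      smooth_curve TA D (field_lift c N),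
      (forall t, D t -> g_inner (c t) (N t) (N t) (N t) = 1) &
      (forall t, D t -> g_inner (c t) (N t) (N t) (velocity A c t) = 0)].

Definition sigma_along (c : R -> M) (N : R -> E) (t : R) : R :=
  omega1 (field_lift c N t) (velocity TA (field_lift c N) t).

Definition parallel_curvature (D : set R) (c : R -> M) (N : R -> E)
    (k : R -> R) : Prop :=
  forall t, D t ->
    cov_deriv c N N t = - (k t / sigma_along c N t ^+ 2) *: velocity A c t.

(** ** The Euler-Lagrange system of (omega2, omega1; omega1) *)

Notation EZ := ((E * E) * R^o)%type.
Notation ZZ := (TM * R)%type.
Notation ZA := (line_charts TA).

(* [Z] is the product of [Sigma] with the line, seen inside the tangent bundle
   times the line; forms on [Z] are again restrictions of ambient forms. *)
Definition Zspace : set ZZ := [set zt | Sigma zt.1].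

Definition tangent_Zspace (zt : ZZ) (v : EZ) : Prop := tangent_Sigma zt.1 v.1.

Definition psi (zt : ZZ) (v : EZ) : R :=
  omega1 zt.1 v.1 + zt.2 * omega2 zt.1 v.1.

Definition Psi (zt : ZZ) (u v : EZ) : R := dform ZA psi zt u v.

(* Only the value of a vector field at [zt] matters for its contraction there. *)
Definition cartan_system (zt : ZZ) : set (EZ -> R) :=
  [set theta | exists2 v, tangent_Zspace zt v & theta = Psi zt v].

Definition integral_element (zt : ZZ) (v : EZ) : Prop :=
  (forall theta, cartan_system zt theta -> theta v = 0) /\ omega1 zt.1 v.1 <> 0.

Fixpoint Ziter (n : nat) : set ZZ :=
  match n with
  | 0 => Zspace
  | n'.+1 => [set zt | Ziter n' zt /\
      exists2 v, tangent_to ZA (Ziter n') zt v & integral_element zt v]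
  end.

(* The sequence is decreasing, so this is the set at which it stabilizes. *)
Definition Ystable : set ZZ := \bigcap_n Ziter n.

Definition EL_integral_curve (D : set R) (c : R -> ZZ) : Prop :=
  smooth_curve ZA D c /\
  forall t, D t -> Ystable (c t) /\ integral_element (c t) (velocity ZA c t).

Definition satisfies_EL (D : set R) (h : R -> TM) : Prop :=
  exists2 c, EL_integral_curve D c & forall t, D t -> (c t).1 = h t.

End Finsler.

(* Main.v *)
Require Import Defs.
From HB Require Import structures.
From mathcomp Require Import all_boot all_order all_algebra.
From mathcomp Require Import all_classical all_reals all_analysis.
From mathcomp Require Import ring lra.
Import Order.TTheory GRing.Theory Num.Theory.
Import numFieldNormedType.Exports.
Local Open Scope classical_set_scope.
Local Open Scope ring_scope.

(** By the structure equations, d(omega1 + lambda omega2) equals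
    - (I + lambda) omega1 /\ omega3 + omega2 /\ (omega3 - d lambda), so a vector
    with omega1 <> 0 is an integral element of the Cartan system exactly when
    lambda = - I, omega2 = 0 and omega3 = d lambda. Along the normal lift this is
    dI + omega3 = 0; conversely, under this condition the curve
    (lift, - I o lift) consists of integral elements, so all its points survive
    every step of the reduction to Y.

    For the second equation one needs the value of omega3 on the velocity
    (T, N') of the lift. With P the nonlinear connection, the geodesic spray
    w = (y, - P y) satisfies d omega2 (., w) = 0, whence omega3 w = 0 and
    omega3 u = d omega1 (w, u) when omega2 u = 0. In coordinates the latter is omega1 evaluated on
    the horizontal vector N' + P T, that is on the covariant derivative of N,
    which is - (k / sigma^2) T; here one uses that the derivative of
    log (sqrt (det g)) along w is the trace of P. *)

Set Implicit Arguments.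
Unset Strict Implicit.
Unset Printing Implicit Defensive.

(** * Maps of class C^k *)

Section Calculus.
Context {R : realType}.
Implicit Types V W : normedModType R.

(** Two obstacles shape the proof. Tangent vectors are stored in the preferred chart of their base
    point, and that chart may change from one point to the next inside the expression that [dform]
    differentiates. The forms [omega1] and [omega2] must therefore be shown to have the same
    coordinate formula in every chart. For [omega1] this is where the orientation enters: the square
    root of a squared Jacobian determinant is the determinant itself only if that is positive. The
    other obstacle is the size of the Chern connection as an expression in the metric and its
    derivatives. In dimension two homogeneity leaves a single free scalar in the vertical
    derivatives of the metric, after which every contraction needed is an identity between rational
    functions of finitely many numbers.

    The spray is the right vector to contract with because it is dual to [omega2] in the coframe:
    [omega1 w = 0] and [omega2 w = 1], so the structure equations contracted with it isolate
    [omega3]. *)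

Lemma near_eq_differentiable V W (f g : V -> W) x :
  (\near x, f x = g x) -> differentiable f x -> differentiable g x.
Proof.
move=> fg df.
have dg : g \o shift x = cst (g x) + 'd f x +o_ 0 id.
  apply/eqaddoP => e e0; have /diff_locally/eqaddoP/(_ e e0) := df.
  rewrite -(nbhs_singleton fg); apply: filter_app; rewrite near_simpl.
  have fg' : \forall h \near (0 : V), f (h + x) = g (h + x).
    by have := fg; rewrite (near_shift 0) subr0.
  by near=> h; rewrite /= !fctE /= (near fg' h).
have cdf : continuous ('d f x) by exact: diff_continuous.
apply/diff_locallyP; have -> : 'd g x = 'd f x :> (V -> W) by exact: diff_unique.
by split.
Unshelve. all: by end_near. Qed.

Lemma open_near V (U : set V) (P : V -> Prop) x :
  open U -> U x -> (forall y, U y -> P y) -> \near x, P x.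
Proof. by move=> oU Ux UP; apply: filterS UP _; exact: open_nbhs_nbhs. Qed.

Lemma deriveDr V W (f : V -> W) x u v : differentiable f x ->
  'D_(u + v) f x = 'D_u f x + 'D_v f x.
Proof. by move=> df; rewrite !deriveE// linearD. Qed.

Lemma deriveZr V W (f : V -> W) x a v : differentiable f x ->
  'D_(a *: v) f x = a *: 'D_v f x.
Proof. by move=> df; rewrite !deriveE// linearZ. Qed.

Lemma derive_sumr V W (f : V -> W) x (I : finType) (v : I -> V) : differentiable f x ->
  'D_(\sum_i v i) f x = \sum_i 'D_(v i) f x.
Proof.
move=> df; rewrite deriveE// linear_sum.
by apply: eq_bigr => i _; rewrite deriveE.
Qed.

Lemma derive_comp V' V W (f : V' -> V) (g : V -> W) x v :
  differentiable f x -> differentiable g (f x) ->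
  'D_v (g \o f) x = 'D_('D_v f x) g (f x).
Proof.
move=> df dg; rewrite !deriveE//; last exact: differentiable_comp.
by rewrite diff_comp.
Qed.

Lemma is_derive_pair V' V W (f : V' -> V) (g : V' -> W) x v df dg :
  is_derive x v f df -> is_derive x v g dg ->
  is_derive x v (fun y => (f y, g y)) (df, dg).
Proof.
move=> [+ <-] [+ <-] => /= cf cg.
have c : (fun h => h^-1 *: (((fun y => (f y, g y)) \o shift x) (h *: v)
     - (f x, g x))) @ 0^' --> ('D_v f x, 'D_v g x).
  by apply: (cvg_pair (f := fun h => h^-1 *: ((f \o shift x) (h *: v) - f x))
    (g := fun h => h^-1 *: ((g \o shift x) (h *: v) - g x))).
by split; [apply/cvg_ex; eexists; exact: c | exact: cvg_lim c].
Qed.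

Lemma is_derive_linear V W (f : {linear V -> W}) x v :
  is_derive x v f (f v).
Proof.
have e : (fun h => h^-1 *: ((f \o shift x) (h *: v) - f x)) @ 0^' --> f v.
  apply: cvg_near_cst; rewrite near_withinE; near=> h => h0 /=.
  by rewrite [f (_ + _)]linearD addrK [f _]linearZ /= scalerA mulVf// scale1r.
by split; [apply/cvg_ex; eexists; exact: e | exact: cvg_lim e].
Unshelve. all: by end_near. Qed.


Lemma is_derive_fst V W (z v : V * W) : is_derive z v (fst : V * W -> V) v.1.
Proof. by have := is_derive_linear (fst : {linear (V * W)%type -> V}) z v. Qed.

Lemma is_derive_snd V W (z v : V * W) : is_derive z v (snd : V * W -> W) v.2.
Proof. by have := is_derive_linear (snd : {linear (V * W)%type -> W}) z v. Qed.

Lemma differentiable_fst V W (z : V * W) : differentiable (fst : V * W -> V) z.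
Proof.
have c : continuous (fst : {linear (V * W)%type -> V}) by move=> x; exact: cvg_fst.
by have := linear_differentiable z c.
Qed.

Lemma differentiable_snd V W (z : V * W) : differentiable (snd : V * W -> W) z.
Proof.
have c : continuous (snd : {linear (V * W)%type -> W}) by move=> x; exact: cvg_snd.
by have := linear_differentiable z c.
Qed.

Lemma is_derive_comp_fst V V' W (f : V -> W) (x v : V * V') df :
  is_derive x.1 v.1 f df -> is_derive x v (fun x => f x.1) df.
Proof. by case=> c e; split. Qed.

Lemma is_deriveMo V (f g : V -> R^o) x v (df dg : R^o) :
  is_derive x v f df -> is_derive x v g dg ->
  is_derive x v (fun y => f y * g y : R^o) (df * g x + f x * dg : R^o).
Proof.
move=> hf hg; apply: (is_derive_eq (@is_deriveM R V f g x v df dg hf hg)).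
by rewrite addrC; congr (_ + _); exact: mulrC.
Qed.

Lemma is_deriveBo V W (f g : V -> W) x v (df dg : W) :
  is_derive x v f df -> is_derive x v g dg ->
  is_derive x v (fun y => f y - g y) (df - dg).
Proof. by move=> hf hg; exact: (@is_deriveB R V W f g x v df dg hf hg). Qed.

Lemma differentiableMo V (f g : V -> R^o) x :
  differentiable f x -> differentiable g x ->
  differentiable (fun y => f y * g y : R^o) x.
Proof. by move=> df dg; exact: (@differentiableM R V f g x). Qed.

Lemma diff_is_derive V W (f : V -> W) x v :
  differentiable f x -> is_derive x v f ('D_v f x).
Proof. by move=> df; apply/derivableP/diff_derivable. Qed.

Lemma is_derive_sqrt V (h : V -> R^o) x v :
  differentiable h x -> 0 < h x ->
  is_derive x v (fun x => Num.sqrt (h x) : R^o) ('D_v h x / (2 * Num.sqrt (h x)) : R^o).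
Proof.
move=> dh hx.
have [c e] := is_derive1_sqrt hx.
have ds : differentiable (Num.sqrt : R -> R) (h x) by exact/derivable1_diffP.
have dc := differentiable_comp dh ds.
apply: (is_derive_eq (diff_is_derive v dc)).
rewrite derive_comp//.
have -> : 'D_v h x = 'D_v h x *: (1 : R) by rewrite [RHS]mulr1.
by rewrite deriveZr// e [X in _ = X / _]mulr1.
Qed.

Lemma derive_shift_comp V W (f : V -> W) t x v :
  'D_v (fun y => f (y + t)) x = 'D_v f (x + t).
Proof.
by rewrite /derive; apply: (congr1 (fun d : R -> W => lim (d @ 0^')));
  apply/funext => h /=; rewrite addrA.
Qed.

End Calculus.

(** * Closure of the C^k classes under algebra, composition and translation *)

Section Ck.
Context {R : realType}.
Implicit Types V W : normedModType R.

Lemma Ck_on_ext V W k (U : set V) (f g : V -> W) : open U ->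
  (forall x, U x -> f x = g x) -> Ck_on k U f -> Ck_on k U g.
Proof.
move=> oU; elim: k f g => [|k IH] f g fg /= => [cf x Ux|[df Df]].
  have e := open_near oU Ux fg.
  rewrite /prop_for /continuous_at -(nbhs_singleton e).
  exact: cvg_trans (near_eq_cvg e) (cf x Ux).
split=> [x Ux|v]; first exact: near_eq_differentiable (open_near oU Ux fg) (df x Ux).
apply: (IH (fun x => 'D_v f x)); last exact: Df.
by move=> x Ux; apply: near_eq_derive; exact: open_near oU Ux fg.
Qed.

(** The product and chain rules leave some factors undifferentiated; their order has to come down
    before an induction hypothesis applies to them. *)
Lemma Ck_on_pred V W k (U : set V) (f : V -> W) : Ck_on k.+1 U f -> Ck_on k U f.
Proof.
elim: k f => [|k IH] f [df Df] => [x Ux|].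
  exact/differentiable_continuous/df.
by split=> // v; apply: IH; exact: Df.
Qed.

Lemma Ck_on_cst V W k (U : set V) (a : W) : Ck_on k U (cst a).
Proof.
elim: k a => [|k IH] a /=; first by move=> x _; exact: cst_continuous.
split=> // v; rewrite (_ : (fun _ => _) = cst 0); first exact: IH.
by apply/funext => x; rewrite derive_cst.
Qed.

Lemma Ck_onD V W k (U : set V) (f g : V -> W) : open U ->
  Ck_on k U f -> Ck_on k U g -> Ck_on k U (fun x => f x + g x).
Proof.
move=> oU; elim: k f g => [|k IH] f g /= => [cf cg x Ux|[df Df] [dg Dg]].
  by apply: continuousD; [exact: cf|exact: cg].
split=> [x Ux|v]; first by apply: differentiableD; [exact: df|exact: dg].
apply: Ck_on_ext (IH _ _ (Df v) (Dg v)) => // x Ux.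
by rewrite deriveD//; apply: diff_derivable; [exact: df|exact: dg].
Qed.

Lemma Ck_on_sum V W k (U : set V) (I : finType) (f : I -> V -> W) : open U ->
  (forall i, Ck_on k U (f i)) -> Ck_on k U (fun x => \sum_i f i x).
Proof.
move=> oU Cf; elim: (index_enum I) => [|i r IH].
  by apply: Ck_on_ext (Ck_on_cst k U 0) => // x _; rewrite big_nil.
by apply: Ck_on_ext (Ck_onD oU (Cf i) IH) => // x _; rewrite big_cons.
Qed.

Lemma Ck_onM V k (U : set V) (f g : V -> R^o) : open U ->
  Ck_on k U f -> Ck_on k U g -> Ck_on k U (fun x => f x * g x : R^o).
Proof.
move=> oU; elim: k f g => [|k IH] f g /=.
  by move=> cf cg x Ux; apply: continuousM; [exact: cf|exact: cg].
move=> Cf Cg; have [df Df] := Cf; have [dg Dg] := Cg.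
split=> [x Ux|v]; first by apply: differentiableMo; [exact: df|exact: dg].
apply: Ck_on_ext (Ck_onD oU (IH _ _ (Df v) (Ck_on_pred Cg))
                            (IH _ _ (Ck_on_pred Cf) (Dg v))) => // x Ux.
by have [_ ->] := is_deriveMo (diff_is_derive v (df x Ux))
  (diff_is_derive v (dg x Ux)).
Qed.

Lemma Ck_on_linear V V' W k (U : set V) (f : V -> V') (L : {linear V' -> W}) :
  open U -> continuous L -> Ck_on k U f -> Ck_on k U (fun x => L (f x)).
Proof.
move=> oU cL; elim: k f => [|k IH] f /= => [cf x Ux|[df Df]].
  by apply: continuous_comp; [exact: cf|exact: cL].
have dL y : differentiable L y by exact: linear_differentiable.
split=> [x Ux|v]; first by apply: differentiable_comp => //; exact: df.
apply: Ck_on_ext (IH _ (Df v)) => // x Ux.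
rewrite (derive_comp (g := L)) //; last exact: df.
by have [_ ->] := is_derive_linear L (f x) ('D_v f x).
Qed.

Lemma Ck_on_pair V V' W k (U : set V) (f : V -> V') (g : V -> W) : open U ->
  Ck_on k U f -> Ck_on k U g -> Ck_on k U (fun x => (f x, g x)).
Proof.
move=> oU; elim: k f g => [|k IH] f g /= => [cf cg x Ux|[df Df] [dg Dg]].
  by apply: cvg_pair; [exact: cf|exact: cg].
split=> [x Ux|v]; first by apply: differentiable_pair; [exact: df|exact: dg].
apply: Ck_on_ext (IH _ _ (Df v) (Dg v)) => // x Ux.
by have [_ ->] := is_derive_pair (diff_is_derive v (df x Ux))
  (diff_is_derive v (dg x Ux)).
Qed.

(** In the chain rule the direction ['D_v c x] varies with [x], whereas [Ck_on] only controls
    derivatives in fixed directions. Expanding that direction on the finite family [b] turns the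
    derivative into a sum of products covered by the induction. *)
Lemma Ck_on_comp V V' (I : finType) (b : I -> V') (l : I -> {linear V' -> R^o}) k
    (U : set V) (U' : set V') (c : V -> V') (f : V' -> R^o) :
  (forall v, v = \sum_i l i v *: b i) -> (forall i, continuous (l i)) ->
  open U -> (forall x, U x -> U' (c x)) ->
  Ck_on k U c -> Ck_on k U' f -> Ck_on k U (fun x => f (c x)).
Proof.
move=> bl cl oU cU; elim: k c f cU => [|k IH] c f cU /=.
  by move=> cc cf x Ux; apply: continuous_comp; [exact: cc|exact/cf/cU].
move=> Cc [df Df]; have [dc Dc] := Cc.
split=> [x Ux|v]; first by apply: differentiable_comp; [exact: dc|exact/df/cU].
have h i : Ck_on k U (fun x => l i ('D_v c x) * 'D_(b i) f (c x) : R^o).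
  apply: Ck_onM => //; first exact: Ck_on_linear (cl i) (Dc v).
  exact: (IH c (fun y => 'D_(b i) f y) cU (Ck_on_pred Cc) (Df (b i))).
apply: Ck_on_ext (Ck_on_sum oU h) => // x Ux.
rewrite (derive_comp (f := c)) //; [|exact: dc|exact/df/cU].
rewrite [in RHS](bl ('D_v c x)) derive_sumr; last exact/df/cU.
by apply: eq_bigr => i _; rewrite deriveZr//; exact/df/cU.
Qed.

Lemma smooth_differentiable V W (U : set V) (f : V -> W) x :
  smooth_on U f -> U x -> differentiable f x.
Proof. by move=> /(_ 1%N)[df _]; exact: df. Qed.

Lemma smooth_derive V W (U : set V) (f : V -> W) v :
  smooth_on U f -> smooth_on U (fun x => 'D_v f x).
Proof. by move=> sf k; have [_ Df] := sf k.+1; exact: Df. Qed.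

Lemma Ck_on_shift V W k (U U' : set V) (f : V -> W) t : open U' ->
  (forall x, U' x -> U (x + t)) -> Ck_on k U f -> Ck_on k U' (fun x => f (x + t)).
Proof.
move=> oU' UU'; elim: k f => [|k IH] f /= => [cf x /UU' Ux|[df Df]].
  apply: (@continuous_comp _ _ _ (+%R^~ t) f); last exact: cf.
  by apply: continuousD; [exact: cvg_id|exact: cst_continuous].
split=> [x /UU' Ux|v].
  have ds : differentiable (fun x : V => x + t) x.
    by apply: differentiableD.
  exact: (differentiable_comp ds (df _ Ux)).
apply: Ck_on_ext (IH _ (Df v)) => // x _.
by rewrite derive_shift_comp.
Qed.

End Ck.

(** * Charts of the tangent bundle *)

Section Atlas.
Context {R : realType} {E : normedModType R} {M : topologicalType}.
Context {A : charts E M} (hA : smooth_atlas A).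
Implicit Types (a b : chart_index A) (p : M) (U : set M) (x v w : E).

Lemma chart_at_dom p : chart_dom (chart_at A p) p.
Proof. by have [] := hA. Qed.

Lemma unchartK a p : chart_dom a p -> unchart a (chart_map a p) = p.
Proof. by have [_ _ + _ _] := hA; exact. Qed.

Lemma chart_imageP a U x : chart_image a U x <->
  [/\ chart_dom a (unchart a x), U (unchart a x) & chart_map a (unchart a x) = x].
Proof.
split=> [[p [ap Up] <-]|[ax Ux xE]]; first by rewrite unchartK.
by exists (unchart a x).
Qed.

Lemma chart_image_mem a U p : chart_dom a p -> U p -> chart_image a U (chart_map a p).
Proof. by move=> ap Up; exists p. Qed.

Lemma chart_image_chart_at a U x : chart_image a U x ->
  chart_image a (chart_dom (chart_at A (unchart a x))) x.
Proof.
by move=> /chart_imageP[ax _ xE]; apply/chart_imageP; split=> //; exact: chart_at_dom.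
Qed.

Lemma open_chart_image a U : open U -> open (chart_image a U).
Proof.
move=> oU; have [_ od _ cont _] := hA.
rewrite openE => x ax; have /chart_imageP[dx Ux xE] := ax.
have cx : {for x, continuous (unchart a)} by rewrite -xE; have [] := cont _ _ dx.
have oi : nbhs x (chart_map a @` chart_dom a).
  by apply: open_nbhs_nbhs; split; [case: (od a)|exists (unchart a x)].
have oU' : nbhs x (unchart a @^-1` U).
  by apply: cx; exact: open_nbhs_nbhs.
apply: filterS2 oi oU' => _ [p ap <-] /= Up.
by exists p => //; split=> //; move: Up; rewrite unchartK.
Qed.

Lemma open_chart_image_dom a b : open (chart_image a (chart_dom b)).
Proof. by apply: open_chart_image; have [_ + _ _ _] := hA => /(_ b)[]. Qed.

Lemma transition_id a U x : chart_image a U x -> transition a a x = x.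
Proof. by move=> /chart_imageP[]. Qed.

Lemma derive_transition_id a U x v : open U -> chart_image a U x ->
  'D_v (transition a a) x = v.
Proof.
move=> oU ax; rewrite -[RHS](derive_id x v); apply: near_eq_derive.
by apply: (open_near (open_chart_image a oU) ax) => y /transition_id.
Qed.

Lemma transition_smooth a b : smooth_on (chart_image a (chart_dom b)) (transition a b).
Proof. by have [_ _ _ _ s] := hA; exact: s. Qed.

Lemma transition_differentiable a b x : chart_image a (chart_dom b) x ->
  differentiable (transition a b) x.
Proof. by have [df _] := @transition_smooth a b 1; exact: df. Qed.

Lemma transition_comp a b c x v : chart_image a (chart_dom b `&` chart_dom c) x ->
  'D_('D_v (transition a b) x) (transition b c) (transition a b x)
    = 'D_v (transition a c) x.
Proof.
move=> ax; have /chart_imageP[dx [bx cx] xE] := ax.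
have abx : chart_image a (chart_dom b) x by apply/chart_imageP.
rewrite -derive_comp; first last.
- apply: transition_differentiable; apply/chart_imageP.
  by rewrite /transition /= unchartK.
- exact: transition_differentiable.
apply: near_eq_derive; apply: (open_near (open_chart_image_dom a b) abx).
by move=> y /chart_imageP[ay yb yE]; rewrite /transition /= unchartK.
Qed.

(** Both operations pass through the preferred chart of the point; the chain rule for transition
    maps cancels this intermediate chart. *)
Lemma vec_coord_unchart a b x w : chart_image a (chart_dom b) x ->
  vec_coord b (unchart a x) (vec_unchart a x w) = 'D_w (transition a b) x.
Proof.
move=> /chart_imageP[ax bx xE]; rewrite /vec_coord /vec_unchart.
rewrite -[chart_map _ _]/(transition a (chart_at A (unchart a x)) x).
by rewrite transition_comp//; apply/chart_imageP; do !split=> //; exact: chart_at_dom.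
Qed.

Lemma open_chart_dom a : open (chart_dom a).
Proof. by have [_ + _ _ _] := hA => /(_ a)[]. Qed.

Lemma vec_unchartK a U x w : chart_image a U x ->
  vec_coord a (unchart a x) (vec_unchart a x w) = w.
Proof.
move=> /chart_imageP[ax _ xE]; have aax : chart_image a (chart_dom a) x.
  by apply/chart_imageP.
by rewrite vec_coord_unchart// (derive_transition_id w (@open_chart_dom a) aax).
Qed.

Lemma vec_coordK a p v : chart_dom a p ->
  vec_unchart a (chart_map a p) (vec_coord a p v) = v.
Proof.
move=> ap; have bp := chart_at_dom p.
rewrite /vec_coord /vec_unchart unchartK//.
have bpx : chart_image (chart_at A p) (chart_dom a) (chart_map (chart_at A p) p).
  exact: chart_image_mem.
have pE : chart_map a p = transition (chart_at A p) a (chart_map (chart_at A p) p).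
  by rewrite /transition /= unchartK.
rewrite pE transition_comp; last by apply: chart_image_mem.
by apply: (derive_transition_id v (@open_chart_dom (chart_at A p))); exact: chart_image_mem.
Qed.

Lemma vec_coord_id p v : vec_coord (chart_at A p) p v = v.
Proof.
apply: (derive_transition_id v (@open_chart_dom (chart_at A p))).
by apply: chart_image_mem; exact: chart_at_dom.
Qed.

Lemma vec_unchart_id p v : vec_unchart (chart_at A p) (chart_map (chart_at A p) p) v = v.
Proof. by rewrite -{1}[v](vec_coord_id p) vec_coordK//; exact: chart_at_dom. Qed.

Lemma vec_unchart_lin a U x : chart_image a U x ->
  forall k v w, vec_unchart a x (k *: v + w) = k *: vec_unchart a x v + vec_unchart a x w.
Proof.
move=> /chart_image_chart_at ax k v w.
by rewrite /vec_unchart deriveDr ?deriveZr//; exact: transition_differentiable.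
Qed.

Lemma vec_unchart0 a x : vec_unchart a x 0 = 0.
Proof. exact: derive0. Qed.

Lemma vec_coord0 a p : vec_coord a p 0 = 0.
Proof. exact: derive0. Qed.

Lemma vec_unchart_eq0 a U x w : chart_image a U x -> (vec_unchart a x w == 0) = (w == 0).
Proof.
move=> ax; apply/eqP/eqP => [e|->]; last exact: vec_unchart0.
by rewrite -(vec_unchartK w ax) e vec_coord0.
Qed.

Notation TA := (tangent_charts A).

(** Being nonzero does not depend on the chart. In coordinates the slit bundle is thus an open set
    times the nonzero vectors, which yields its openness without any topology on [M * E]. *)
Lemma tangent_chart_imageP a z : chart_image (A := TA) a [set xi | xi.2 != 0] z <->
  chart_image a setT z.1 /\ z.2 != 0.
Proof.
split=> [[[p v] /= [ap v0] <-] /=|[ax z0]].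
  split; first exact: chart_image_mem.
  apply/eqP => e; move/eqP: v0; apply; rewrite -(vec_coordK v ap) e.
  exact: vec_unchart0.
have /chart_imageP[dx _ xE] := ax.
exists (unchart a z.1, vec_unchart a z.1 z.2) => /=.
  by split=> //=; rewrite (vec_unchart_eq0 z.2 ax).
by rewrite xE (vec_unchartK z.2 ax); case: (z).
Qed.

Lemma open_tangent_chart_image a :
  open (chart_image (A := TA) a [set xi | xi.2 != 0]).
Proof.
rewrite (_ : chart_image _ _ = [set z | chart_image a setT z.1] `&`
    [set z : E * E | z.2 != 0]); last first.
  by apply/seteqP; split=> z; rewrite tangent_chart_imageP.
apply: openI.
- apply: (open_comp (f := fst)) (open_chart_image a openT).
  by move=> z _; exact: cvg_fst.
- apply: (open_comp (f := snd) (D := [set y : E | y != 0])).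
    by move=> z _; exact: cvg_snd.
  rewrite (_ : [set y | _] = ~` [set 0]).
    exact/closed_openC/accessible_closed_set1/hausdorff_accessible/norm_hausdorff.
  by apply/seteqP; split=> y /eqP.
Qed.

Lemma tangent_transition a b z : chart_image a (chart_dom b) z.1 ->
  transition (A := TA) a b z =
    (transition a b z.1, 'D_(z.2) (transition a b) z.1).
Proof. by move=> ax; rewrite /transition /= vec_coord_unchart. Qed.

End Atlas.

(** * Coordinates on the tangent bundle and Euler's relation for homogeneous functions *)

Section Coordinates.
Context {R : realType}.
Notation E := 'rV[R]_2.
Implicit Types (z v : E * E) (f : E * E -> R) (i j k : 'I_2).

Lemma sum2E (V : nmodType) (G : 'I_2 -> V) : \sum_i G i = G 0 + G 1.
Proof.
by rewrite !big_ord_recl big_ord0 addr0; congr (_ + G _); exact/val_inj.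
Qed.

Lemma row2E (x : E) : x = \sum_i x 0 i *: evec i.
Proof. exact: row_sum_delta. Qed.

Lemma pair_coordE v : v = \sum_i v.1 0 i *: (evec i, 0) + \sum_i v.2 0 i *: (0, evec i).
Proof.
rewrite !sum2E; case: v => x y; congr (_, _) => /=.
  by rewrite !scaler0 !addr0 {1}(row2E x) sum2E.
by rewrite !scaler0 !add0r {1}(row2E y) sum2E.
Qed.

Lemma derive_coord f z v : differentiable (f : _ -> R^o) z ->
  'D_v (f : _ -> R^o) z = \sum_i v.1 0 i * dx i f z + \sum_i v.2 0 i * dy i f z.
Proof.
move=> df; rewrite {1}(pair_coordE v) deriveDr// !derive_sumr//.
by congr (_ + _); apply: eq_bigr => i _; rewrite deriveZr.
Qed.

Lemma derive_vertical f z (v : E) :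
  differentiable (f : _ -> R^o) z -> 'D_(0, v) (f : _ -> R^o) z = \sum_i v 0 i * dy i f z.
Proof.
move=> df; rewrite derive_coord// -[RHS]add0r; congr (_ + _).
by rewrite big1// => i _; rewrite mxE mul0r.
Qed.

Definition base_coord i z : R^o := z.1 0 i.

Definition fiber_coord i z : R^o := z.2 0 i.

Fact base_coord_linear i : linear (base_coord i).
Proof. by move=> r z v; rewrite /base_coord /= !mxE. Qed.

Fact fiber_coord_linear i : linear (fiber_coord i).
Proof. by move=> r z v; rewrite /fiber_coord /= !mxE. Qed.

HB.instance Definition _ i := GRing.isLinear.Build R (E * E)%type R^o _
  (base_coord i) (base_coord_linear i).

HB.instance Definition _ i := GRing.isLinear.Build R (E * E)%type R^o _
  (fiber_coord i) (fiber_coord_linear i).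

Lemma is_derive_fiber_coord i z v : is_derive z v (fiber_coord i) (v.2 0 i : R^o).
Proof. by have := is_derive_linear (fiber_coord i) z v. Qed.

Lemma base_coord_continuous i : continuous (base_coord i).
Proof.
move=> z; apply: (@continuous_comp _ _ _ fst (fun x : E => x 0 i)).
  exact: cvg_fst.
exact: coord_continuous.
Qed.

Lemma fiber_coord_continuous i : continuous (fiber_coord i).
Proof.
move=> z; apply: (@continuous_comp _ _ _ snd (fun x : E => x 0 i)).
  exact: cvg_snd.
exact: coord_continuous.
Qed.

Lemma differentiable_fiber_coord i z : differentiable (fiber_coord i) z.
Proof. by have := linear_differentiable z (@fiber_coord_continuous i). Qed.

Definition dilation (r : R) z : E * E := (z.1, r *: z.2).

Lemma differentiable_dilation r z : differentiable (dilation r) z.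
Proof.
apply: differentiable_pair; first exact: differentiable_fst.
by apply: differentiableZ; exact: differentiable_snd.
Qed.

Lemma derive_dilation r z v : 'D_v (dilation r) z = dilation r v.
Proof.
have d2 : is_derive z v (fun z => r *: z.2 : E) (r *: v.2).
  exact: (@is_deriveZ _ _ _ snd r z v v.2 (is_derive_snd z v)).
by have [_ ->] := is_derive_pair (is_derive_fst z v) d2.
Qed.

(** Differentiate the homogeneity relation along the radial line through [z], on which the dilation
    factor is [t + 1], at [t = 0]. *)
Lemma euler f n z : differentiable (f : _ -> R^o) z ->
  (forall r, 0 < r -> f (dilation r z) = r ^+ n * f z) ->
  \sum_i z.2 0 i * dy i f z = n%:R * f z.
Proof.
move=> df hf.
have -> : \sum_i z.2 0 i * dy i f z = 'D_(0, z.2) (f : _ -> R^o) z.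
  by rewrite derive_coord//= [X in X + _]big1 ?add0r// => i _; rewrite mxE mul0r.
have -> : 'D_(0, z.2) (f : _ -> R^o) z
    = 'D_1 (fun t : R => f (t *: (0, z.2) + z) : R^o) 0.
  rewrite /derive; apply: (congr1 (fun d : R -> R^o => lim (d @ 0^'))).
  apply/funext => h /=.
  by rewrite addr0 scale0r add0r [_%:A]mulr1.
have e : \forall t \near (0 : R),
    (fun t : R => (t + 1) ^+ n * f z : R^o) t = (f (t *: (0, z.2) + z) : R^o).
  near=> t; rewrite -hf; last first.
    rewrite -ltrBlDr sub0r; near: t; apply: lt_nbhsr; lra.
  by congr f; rewrite /dilation; congr (_, _); rewrite /= ?scaler0 ?add0r// scalerDl scale1r.
rewrite -(near_eq_derive _ e).
have d1 : is_derive (0 : R) 1 (fun t : R => t + 1 : R^o) (1 + 0).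
  by apply: is_deriveD.
have d2 : is_derive (0 : R) 1 (fun t : R => (t + 1) ^+ n : R^o) (n%:R : R^o).
  rewrite (_ : (fun t => _) = (fun t : R => t + 1 : R^o) ^+ n); last first.
    by rewrite exprfctE.
  apply: is_derive_eq (@is_deriveX _ _ _ n _ _ _ d1) _.
  by rewrite add0r expr1n addr0 mulr1 [LHS]mulr1.
have [_ d3] := is_deriveMo d2 (is_derive_cst (f z : R^o) (0 : R) (1 : R)).
apply: (etrans d3); by rewrite mulr0 addr0.
Unshelve. all: by end_near. Qed.

(** The chain rule through the dilation produces a factor [r], which cancels one power: a vertical
    derivative lowers the degree of homogeneity by one. *)
Lemma dy_dilation f n (U : set (E * E)) : open U ->
  (forall z r, U z -> 0 < r -> U (dilation r z)) ->
  (forall z, U z -> differentiable (f : _ -> R^o) z) ->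
  (forall z r, U z -> 0 < r -> f (dilation r z) = r ^+ n.+1 * f z) ->
  forall j z r, U z -> 0 < r -> dy j f (dilation r z) = r ^+ n * dy j f z.
Proof.
move=> oU Ud df hf j z r Uz r0.
have ed : dilation r (0, evec j) = r *: (0, evec j).
  by congr (_, _); rewrite /= ?scaler0.
have e1 : 'D_(0, evec j) (fun z' => f (dilation r z') : R^o) z = r * dy j f (dilation r z).
  rewrite (derive_comp (f := dilation r) (g := f : _ -> R^o)).
  - rewrite derive_dilation ed deriveZr//; exact/df/Ud.
  - exact: differentiable_dilation.
  - exact/df/Ud.
have e2 : 'D_(0, evec j) (fun z' => f (dilation r z') : R^o) z = r ^+ n.+1 * dy j f z.
  have e : \near z, f (dilation r z) = (r ^+ n.+1 *: (f : _ -> R^o)) z.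
    by apply: (open_near oU Uz) => y Uy; rewrite hf.
  rewrite (near_eq_derive _ e) deriveZ//.
  exact/diff_derivable/df.
apply: (mulfI (lt0r_neq0 r0)); rewrite -e1 e2 exprS mulrA //.
Qed.

End Coordinates.

(** * The fundamental tensor in a chart *)

Section FinslerChart.
Context {R : realType} {M : topologicalType} {A : charts 'rV[R]_2 M}.
Context (hA : smooth_atlas A) {F : M * 'rV[R]_2 -> R} (hF : finsler_metric A F).
Notation E := 'rV[R]_2.
Notation TA := (tangent_charts A).
Implicit Types (a : chart_index A) (z v : E * E) (i j k m : 'I_2).

Definition slit_image a := chart_image (A := TA) a slit.

Lemma slit_imageP a z : slit_image a z <-> chart_image a setT z.1 /\ z.2 != 0.
Proof. exact: tangent_chart_imageP. Qed.

Lemma open_slit_image a : open (slit_image a).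
Proof. exact: open_tangent_chart_image. Qed.

Lemma slit_image_dilation a z r : slit_image a z -> 0 < r -> slit_image a (dilation r z).
Proof.
move=> /slit_imageP[az z0] r0; apply/slit_imageP; split=> //=.
by rewrite scaler_eq0 negb_or z0 gt_eqF.
Qed.

Lemma loc_F_dilation a z r : slit_image a z -> 0 < r ->
  loc_F F a (dilation r z) = r * loc_F F a z.
Proof.
move=> /slit_imageP[az _] r0; have [_ _ hom _] := hF.
rewrite /loc_F /= -hom//; congr (F (_, _)).
by have := vec_unchart_lin hA az r z.2 0; rewrite !addr0 vec_unchart0 addr0.
Qed.

Lemma loc_F_smooth a : smooth_on (slit_image a) (loc_F F a : _ -> R^o).
Proof. by have [_ sF _ _] := hF; exact: sF. Qed.

Definition sq_F a z : R := loc_F F a z ^+ 2.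

Lemma sq_F_smooth a : smooth_on (slit_image a) (sq_F a : _ -> R^o).
Proof.
by move=> k; apply: Ck_onM; [exact: open_slit_image|exact: loc_F_smooth..].
Qed.

Lemma dy_sq_F_smooth a j : smooth_on (slit_image a) (dy j (sq_F a) : _ -> R^o).
Proof. exact/smooth_derive/sq_F_smooth. Qed.

Lemma g_smooth a i j : smooth_on (slit_image a) (fun z => g F a z i j : R^o).
Proof.
move=> k; apply: (Ck_onM (f := cst 2^-1)); [exact: open_slit_image|exact: Ck_on_cst|].
exact/smooth_derive/dy_sq_F_smooth.
Qed.

Lemma loc_F_differentiable a z : slit_image a z ->
  differentiable (loc_F F a : _ -> R^o) z.
Proof. exact/smooth_differentiable/loc_F_smooth. Qed.

Lemma sq_F_differentiable a z : slit_image a z ->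
  differentiable (sq_F a : _ -> R^o) z.
Proof. exact/smooth_differentiable/sq_F_smooth. Qed.

Lemma dy_sq_F_differentiable a j z : slit_image a z ->
  differentiable (dy j (sq_F a) : _ -> R^o) z.
Proof. exact/smooth_differentiable/dy_sq_F_smooth. Qed.

Lemma g_differentiable a i j z : slit_image a z ->
  differentiable (fun z => g F a z i j : R^o) z.
Proof. exact/smooth_differentiable/g_smooth. Qed.

Lemma derive_near_slit a (f h : E * E -> R) z v : slit_image a z ->
  (forall z, slit_image a z -> f z = h z) ->
  'D_v (f : _ -> R^o) z = 'D_v (h : _ -> R^o) z.
Proof.
by move=> az fh; apply: near_eq_derive; apply: (open_near (@open_slit_image a) az fh).
Qed.


Lemma sq_F_dilation a z r : slit_image a z -> 0 < r ->
  sq_F a (dilation r z) = r ^+ 2 * sq_F a z.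
Proof. by move=> az r0; rewrite /sq_F loc_F_dilation// exprMn. Qed.

Lemma euler_loc_F a z : slit_image a z ->
  \sum_k z.2 0 k * dy k (loc_F F a) z = loc_F F a z.
Proof.
move=> az; rewrite (euler (n := 1)) ?mul1r//; first exact: loc_F_differentiable.
by move=> r r0; rewrite loc_F_dilation// expr1.
Qed.

Lemma euler_sq_F a z : slit_image a z ->
  \sum_k z.2 0 k * dy k (sq_F a) z = 2 * sq_F a z.
Proof.
move=> az; rewrite (euler (n := 2))//; first exact: sq_F_differentiable.
by move=> r r0; rewrite sq_F_dilation.
Qed.

Lemma gE a z i j : g F a z i j = 2^-1 * dy i (dy j (sq_F a)) z.
Proof. by []. Qed.

Lemma dy_sq_F_dilation a j z r : slit_image a z -> 0 < r ->
  dy j (sq_F a) (dilation r z) = r * dy j (sq_F a) z.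
Proof.
apply: (dy_dilation (n := 1) (@open_slit_image a)).
- by move=> *; exact: slit_image_dilation.
- by move=> *; exact: sq_F_differentiable.
- by move=> *; exact: sq_F_dilation.
Qed.

Lemma g_dilation a i j z r : slit_image a z -> 0 < r ->
  g F a (dilation r z) i j = g F a z i j.
Proof.
move=> az r0; have h : dy i (dy j (sq_F a)) (dilation r z)
    = r ^+ 0 * dy i (dy j (sq_F a)) z.
  apply: (dy_dilation (f := dy j (sq_F a)) (@open_slit_image a)) => //.
  - by move=> *; exact: slit_image_dilation.
  - by move=> *; exact: dy_sq_F_differentiable.
  - by move=> *; exact: dy_sq_F_dilation.
by rewrite !gE h mul1r.
Qed.

(** Euler's relation for the degree one function [dy j (sq_F a)]. The contracted index is that of
    the outer derivative. *)
Lemma g_yl a j z : slit_image a z ->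
  \sum_k g F a z k j * z.2 0 k = 2^-1 * dy j (sq_F a) z.
Proof.
move=> az; rewrite -[dy j _ _]mul1r -(euler (n := 1) (f := dy j (sq_F a))).
- by rewrite mulr_sumr; apply: eq_bigr => k _; rewrite gE; ring.
- exact: dy_sq_F_differentiable.
- by move=> r r0; rewrite dy_sq_F_dilation// expr1.
Qed.

Lemma derive_fiber_contract a (h : 'I_2 -> E * E -> R) z v : slit_image a z ->
  (forall k, differentiable (h k : _ -> R^o) z) ->
  'D_v (fun z => \sum_k z.2 0 k * h k z : R^o) z
    = \sum_k v.2 0 k * h k z + \sum_k z.2 0 k * 'D_v (h k : _ -> R^o) z.
Proof.
move=> az dh; pose t k z : R^o := fiber_coord k z * h k z.
have dt k : is_derive z v (t k) (v.2 0 k * h k z + z.2 0 k * 'D_v (h k : _ -> R^o) z).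
  exact: (is_deriveMo (is_derive_fiber_coord k z v) (diff_is_derive v (dh k))).
rewrite -big_split /=; apply: (etrans _ (derive_val (is_derive := is_derive_sum dt))).
by apply: near_eq_derive; near=> x; rewrite fct_sumE.
Unshelve. all: by end_near. Qed.

Lemma sum_evec j (h : 'I_2 -> R) : \sum_k (evec j : E) 0 k * h k = h j.
Proof.
rewrite (bigD1 j)//= big1 => [|k kj]; rewrite !mxE !eqxx ?mul1r ?addr0//.
by rewrite (negPf kj) mul0r.
Qed.

Lemma sum_zero (h : 'I_2 -> R) : \sum_k (0 : E) 0 k * h k = 0.
Proof. by rewrite big1// => k _; rewrite mxE mul0r. Qed.

Lemma derive_euler_sq_F a z v : slit_image a z ->
  \sum_k v.2 0 k * dy k (sq_F a) z
    + \sum_k z.2 0 k * 'D_v (dy k (sq_F a) : _ -> R^o) z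
  = 2 * 'D_v (sq_F a : _ -> R^o) z.
Proof.
move=> az; rewrite -(derive_fiber_contract (h := fun k => dy k (sq_F a)) v az); last first.
  by move=> k; exact: dy_sq_F_differentiable.
rewrite (derive_near_slit (h := fun z => 2 * sq_F a z) v az); last first.
  by move=> z' az'; rewrite euler_sq_F.
have dL : derivable (sq_F a : _ -> R^o) z v by exact/diff_derivable/sq_F_differentiable.
exact: (deriveZ 2 dL).
Qed.

(** Here the contracted index is that of the inner derivative, and symmetry is not yet known. The
    relation comes from differentiating Euler's identity for [sq_F] in the direction of the j-th
    fibre coordinate. *)
Lemma g_yr a j z : slit_image a z ->
  \sum_k g F a z j k * z.2 0 k = 2^-1 * dy j (sq_F a) z.
Proof.
move=> az; have := derive_euler_sq_F (0, evec j) az.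
rewrite /= sum_evec -/(dy j (sq_F a) z) => e.
have {}e : \sum_k z.2 0 k * dy j (dy k (sq_F a)) z = dy j (sq_F a) z.
  by move: e; rewrite /dy; lra.
by rewrite -e mulr_sumr; apply: eq_bigr => k _; rewrite gE; ring.
Qed.

Lemma ord2P (P : 'I_2 -> Prop) : P 0 -> P 1 -> forall i, P i.
Proof.
move=> P0 P1 [[|[|//]] ltm]; [move: P0|move: P1]; congr P; exact/val_inj.
Qed.

Lemma fiber_neq0 a z : slit_image a z -> z.2 0 0 != 0 \/ z.2 0 1 != 0.
Proof.
move=> /slit_imageP[_ z0]; apply/orP; rewrite -negb_and; apply: contra z0.
move=> /andP[/eqP z0 /eqP z1]; apply/eqP/rowP; apply: ord2P; by rewrite mxE.
Qed.

(* In dimension two the Euler relations alone force the second derivatives to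
   commute, so no theorem on mixed partial derivatives is needed. *)
Lemma g_sym a i j z : slit_image a z -> g F a z i j = g F a z j i.
Proof.
move=> az.
have sym (G : 'I_2 -> 'I_2 -> R) (y L : 'I_2 -> R) : y 0 != 0 \/ y 1 != 0 ->
    (forall j, \sum_k G k j * y k = L j) -> (forall j, \sum_k G j k * y k = L j) ->
    forall i j, G i j = G j i.
  move=> y0 Gl Gr; suff e : G 0 1 = G 1 0 by elim/ord2P => //; elim/ord2P.
  have := Gl 0; have := Gl 1; rewrite -(Gr 0) -(Gr 1) !sum2E => e1 e0.
  by case: y0 => y0; apply: (mulIf y0); lra.
apply: (sym (g F a z) (z.2 0) (fun j => 2^-1 * dy j (sq_F a) z) (fiber_neq0 az)) => k.
  exact: g_yl.
exact: g_yr.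
Qed.

Lemma derive_g_y a j z v : slit_image a z ->
  \sum_k v.2 0 k * g F a z j k + \sum_k z.2 0 k * 'D_v (fun z => g F a z j k : R^o) z
  = 2^-1 * 'D_v (dy j (sq_F a) : _ -> R^o) z.
Proof.
move=> az; rewrite -(derive_fiber_contract (h := fun k z => g F a z j k) v az); last first.
  by move=> k; exact: g_differentiable.
rewrite (derive_near_slit (h := fun z => 2^-1 * dy j (sq_F a) z) v az); last first.
  by move=> z' az'; rewrite -g_yr//; apply: eq_bigr => k _; rewrite mulrC.
have dL : derivable (dy j (sq_F a) : _ -> R^o) z v.
  exact/diff_derivable/dy_sq_F_differentiable.
exact: (deriveZ 2^-1 dL).
Qed.

(** Differentiate [g_yr] in a fibre direction: the term that differentiates [y] and the right-hand
    side are both the entry of [g] at [j] and [m], and they cancel. Classically, the Cartan tensor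
    annihilates [y]. *)
Lemma dy_g_y a m j z : slit_image a z ->
  \sum_k dy m (fun z => g F a z j k) z * z.2 0 k = 0.
Proof.
move=> az; have := derive_g_y j (0, evec m) az; rewrite /= sum_evec.
rewrite -/(dy m (dy j (sq_F a)) z) -gE g_sym// => e.
transitivity (\sum_k z.2 0 k * dy m (fun z => g F a z j k) z).
  by apply: eq_bigr => k _; rewrite mulrC.
by move: e; rewrite /dy; lra.
Qed.

Lemma dx_g_y a m j z : slit_image a z ->
  \sum_k dx m (fun z => g F a z j k) z * z.2 0 k = 2^-1 * dx m (dy j (sq_F a)) z.
Proof.
move=> az; have := derive_g_y j (evec m, 0) az; rewrite /= sum_zero add0r => <-.
by apply: eq_bigr => k _; rewrite mulrC.
Qed.

Lemma dx_dy_sq_F_y a m z : slit_image a z ->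
  \sum_j z.2 0 j * dx m (dy j (sq_F a)) z = 2 * dx m (sq_F a) z.
Proof.
by move=> az; have := derive_euler_sq_F (evec m, 0) az; rewrite /= sum_zero add0r.
Qed.

(** Euler's relation in degree 0. Together with [dy_g_y] and symmetry it says that [y] is
    annihilated in all three slots, the derivative slot included. *)
Lemma y_dy_g a i j z : slit_image a z ->
  \sum_k z.2 0 k * dy k (fun z => g F a z i j) z = 0.
Proof.
move=> az; rewrite (euler (n := 0)) ?mul0r//; first exact: g_differentiable.
by move=> r r0; rewrite g_dilation// mul1r.
Qed.

Lemma derive_g_sym a i j z v : slit_image a z ->
  'D_v (fun z => g F a z i j : R^o) z = 'D_v (fun z => g F a z j i : R^o) z.
Proof. by move=> az; apply: (derive_near_slit _ az) => z' az'; exact: g_sym. Qed.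

End FinslerChart.

Arguments sq_F {R M A} F a z.

(** * The Chern connection and the geodesic spray *)

Section Matrix2.
Context {R : fieldType}.

Lemma det2 (B : 'M[R]_2) : \det B = B 0 0 * B 1 1 - B 0 1 * B 1 0.
Proof.
have e : lift 0 0 = 1 :> 'I_2 by exact/val_inj.
have e' : lift 1 0 = 0 :> 'I_2 by exact/val_inj.
rewrite (expand_det_row _ 0) sum2E /cofactor !det_mx11 !mxE e e' /= expr0 expr1; ring.
Qed.

Lemma invmx2 (B : 'M[R]_2) : \det B != 0 ->
  [/\ invmx B 0 0 = B 1 1 / \det B, invmx B 0 1 = - B 0 1 / \det B,
      invmx B 1 0 = - B 1 0 / \det B & invmx B 1 1 = B 0 0 / \det B].
Proof.
move=> d0; pose h i j : R := if i == j then B (1 - i) (1 - i) else - B i j.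
have hB : (\matrix_(i, j) (h i j / \det B)) *m B = 1%:M.
  apply/matrixP => i j; rewrite !mxE sum2E !mxE /h; move: d0; rewrite det2.
  by elim/ord2P: i; elim/ord2P: j => d0 /=; rewrite ?subr0 ?subrr; field.
have Bu : B \in unitmx by rewrite unitmxE unitfE.
have <- : \matrix_(i, j) (h i j / \det B) = invmx B.
  by rewrite -[LHS](mulmxK Bu) hB mul1mx.
by rewrite !mxE /h /= subrr subr0.
Qed.

End Matrix2.

(** * Pointwise algebra of the Chern connection in dimension two *)

Section ChernAlgebra.
Context {R : realFieldType}.
Variables (G Gi : 'I_2 -> 'I_2 -> R) (GX GY : 'I_2 -> 'I_2 -> 'I_2 -> R) (y : 'I_2 -> R).
Implicit Types i j k m r s : 'I_2.

Let ch i j k := 2^-1 * \sum_s Gi i s * (GX k s j - GX s j k + GX j k s).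
Let C i j k := 2^-1 * \sum_s Gi i s * GY s j k.
Let P i j := \sum_k ch i j k * y k - \sum_k \sum_r \sum_s C i j k * ch k r s * y r * y s.
Let dl k i j := GX k i j - \sum_m P m k * GY m i j.
Let Ga i j k := 2^-1 * \sum_s Gi i s * (dl k s j - dl s j k + dl j k s).
Let S i := \sum_k P i k * y k.

Hypothesis y0 : y 0 != 0 \/ y 1 != 0.
Hypothesis G_sym : forall i j, G i j = G j i.
Hypothesis GX_sym : forall m i j, GX m i j = GX m j i.
Hypothesis GY_sym : forall m i j, GY m i j = GY m j i.
Hypothesis GY_y : forall m i, \sum_k GY m i k * y k = 0.
Hypothesis y_GY : forall i j, \sum_k y k * GY k i j = 0.

(* All contractions of the third vertical derivatives with [y] vanish, so they
   form a multiple of the cube of the covector annihilating [y]. *)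
Let n i : R := if i == 0 then - y 1 else y 0.

Lemma cubic_form : exists t, forall m i j, GY m i j = t * n m * n i * n j.
Proof.
have n0 : n 0 = - y 1 by [].
have n1 : n 1 = y 0 by [].
have s0 := GY_sym 0 1 0; have s1 := GY_sym 1 1 0.
have := GY_y 0 0; have := GY_y 0 1; have := GY_y 1 0; have := GY_y 1 1.
have := y_GY 0 0; have := y_GY 0 1; have := y_GY 1 1.
rewrite !sum2E s0 s1 => a1 a2 a3 a4 a5 a6 a7.
have lin (a b c d : R) : a != 0 -> a * c + b * d = 0 -> c = - b / a * d.
  move=> an e; have h : a * c = - b * d by lra.
  by have -> : c = a * c / a; [field | rewrite h; field].
case: y0 => yn.
  have e1 : GY 1 0 1 = - y 1 / y 0 * GY 1 1 1 by apply: lin => //; lra.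
  have e2 : GY 1 0 0 = - y 1 / y 0 * GY 1 0 1 by apply: lin => //; lra.
  have e3 : GY 0 1 1 = - y 1 / y 0 * GY 1 1 1 by apply: lin => //; lra.
  have e4 : GY 0 0 1 = - y 1 / y 0 * GY 1 0 1 by apply: lin => //; lra.
  have e5 : GY 0 0 0 = - y 1 / y 0 * GY 1 0 0 by apply: lin => //; lra.
  (* The scalar is read off at the component whose three factors [n] are nonzero: here [n 1 = y 0],
     in the other case [n 0 = - y 1], whence the sign there. *)
  exists (GY 1 1 1 / y 0 ^+ 3).
  by elim/ord2P; elim/ord2P; elim/ord2P; rewrite ?n0 ?n1 ?s0 ?s1 ?(e5, e4, e3, e2, e1); field.
have e1 : GY 0 0 1 = - y 0 / y 1 * GY 0 0 0 by apply: lin => //; lra.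
have e2 : GY 0 1 1 = - y 0 / y 1 * GY 0 0 1 by apply: lin => //; lra.
have e3 : GY 1 0 0 = - y 0 / y 1 * GY 0 0 0 by apply: lin => //; lra.
have e4 : GY 1 0 1 = - y 0 / y 1 * GY 0 0 1 by apply: lin => //; lra.
have e5 : GY 1 1 1 = - y 0 / y 1 * GY 0 1 1 by apply: lin => //; lra.
exists (- GY 0 0 0 / y 1 ^+ 3).
by elim/ord2P; elim/ord2P; elim/ord2P; rewrite ?n0 ?n1 ?s0 ?s1 ?(e5, e4, e3, e2, e1); field.
Qed.

(** The Cartan part of [P] disappears under contraction with [y], which leaves the classical
    geodesic coefficients. *)
Lemma spray_christoffel i : S i = \sum_r \sum_s ch i r s * y r * y s.
Proof.
have [t GYE] := cubic_form.
rewrite /S /P /C !sum2E !GYE /n /=; move: (ch); clear => c; ring.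
Qed.

Lemma connectionE i j : P i j = \sum_k ch i j k * y k - \sum_k C i j k * S k.
Proof.
rewrite /P; congr (_ - _); apply: eq_bigr => k _.
rewrite spray_christoffel mulr_sumr; apply: eq_bigr => r _.
by rewrite mulr_sumr; apply: eq_bigr => s _; rewrite !mulrA.
Qed.

(** Of the three vertical corrections in [Ga], two are contracted with [y] on an index of [GY] and
    vanish. The third becomes [GY] contracted with [S], which the total symmetry given by
    [cubic_form] identifies with the Cartan term of [connectionE]. *)
Lemma chern_contract i j : \sum_k Ga i j k * y k = P i j.
Proof.
have [t GYE] := cubic_form.
rewrite connectionE /C /Ga /dl /S /ch !sum2E !GYE /n /=.
move: (P) (Gi) (GX) (y); clear => p gi gx z; elim/ord2P: j => /=; ring.
Qed.

Let D := G 0 0 * G 1 1 - G 0 1 * G 1 0.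
Hypothesis D0 : D != 0.
Hypothesis Gi00 : Gi 0 0 = G 1 1 / D.
Hypothesis Gi01 : Gi 0 1 = - G 0 1 / D.
Hypothesis Gi10 : Gi 1 0 = - G 1 0 / D.
Hypothesis Gi11 : Gi 1 1 = G 0 0 / D.

Let Dg i j := \sum_k y k * GX k i j - \sum_m S m * GY m i j.

(** [Dg] is the derivative of the metric along the spray, and the left-hand side is the resulting
    derivative of the determinant. By Jacobi's formula it is [D] times the trace of [Gi] against
    [Dg], and taking the trace of [P] in [connectionE] gives half of the latter. *)
Lemma spray_det :
  Dg 0 0 * G 1 1 + G 0 0 * Dg 1 1 - (Dg 0 1 * G 1 0 + G 0 1 * Dg 1 0)
    = 2 * D * \sum_i P i i.
Proof.
have [t GYE] := cubic_form.
rewrite (eq_bigr _ (fun i _ => connectionE i i)).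
rewrite /Dg /C; move: (S) => s.
rewrite /ch !sum2E !GYE Gi00 Gi01 Gi10 Gi11 /n /=.
rewrite (GX_sym 0 1 0) (GX_sym 1 1 0) (G_sym 1 0).
move: D0; rewrite /D (G_sym 1 0); move: (G) (GX) (y) => g gx z d0.
by field.
Qed.

(** Lowering the index with [G] cancels [Gi]. The first and third Christoffel terms agree after
    contraction with [y] twice and merge into the coefficient 2. *)
Lemma spray_geodesic j :
  2 * \sum_m G j m * S m
    = \sum_r \sum_s (2 * GX r j s - GX j r s) * y r * y s.
Proof.
rewrite (eq_bigr _ (fun m _ => congr1 (fun x => G j m * x) (spray_christoffel m))).
have GiG : forall i s, \sum_m G i m * Gi m s = (i == s)%:R.
  have d0 := D0; rewrite /D (G_sym 1 0) in d0.
  by elim/ord2P; elim/ord2P; rewrite sum2E ?(Gi00, Gi01, Gi10, Gi11) /D ?(G_sym 1 0) /=; field.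
transitivity (2 * \sum_r \sum_s
    (2^-1 * \sum_q (j == q)%:R * (GX s q r - GX q r s + GX r s q)) * y r * y s).
  rewrite -(eq_bigr _ (fun r _ => eq_bigr _ (fun s _ =>
    congr1 (fun x => 2^-1 * x * y r * y s) (eq_bigr _ (fun q _ =>
      congr1 (fun x => x * (GX s q r - GX q r s + GX r s q)) (GiG j q)))))).
  by rewrite /ch !sum2E; ring.
by elim/ord2P: j; rewrite !sum2E ?(GX_sym 0 1 0) ?(GX_sym 1 1 0) /=; field.
Qed.

End ChernAlgebra.

(** * The spray as the Euler-Lagrange flow of the energy *)

Section Spray.
Context {R : realType} {M : topologicalType} {A : charts 'rV[R]_2 M}.
Context (hA : smooth_atlas A) {F : M * 'rV[R]_2 -> R} (hF : finsler_metric A F).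
Notation E := 'rV[R]_2.
Notation TA := (tangent_charts A).
Implicit Types (a : chart_index A) (z u v : E * E) (i j k m : 'I_2).

Definition spray a z : E * E :=
  (z.2, \row_i - \sum_j nonlinear_connection F a z i j * z.2 0 j).

Lemma det_gE a z :
  \det (g_mx F a z) = g F a z 0 0 * g F a z 1 1 - g F a z 0 1 * g F a z 1 0.
Proof. by rewrite det2 !mxE. Qed.

Section AtPoint.
Context (a : chart_index A) (z : E * E) (az : slit_image a z).
Notation G := (g F a z).
Notation Gi := (g_inv F a z).
Notation GX := (fun k i j => dx k (fun z' => g F a z' i j) z).
Notation GY := (fun k i j => dy k (fun z' => g F a z' i j) z).
Notation w := (spray a z).
Notation L := (sq_F F a).

Let GX_sym m i j : GX m i j = GX m j i.
Proof. exact: derive_g_sym. Qed.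
Let GY_sym m i j : GY m i j = GY m j i.
Proof. exact: derive_g_sym. Qed.
Let GY_y m i : \sum_k GY m i k * z.2 0 k = 0.
Proof. exact: dy_g_y. Qed.
Let y_GY i j : \sum_k z.2 0 k * GY k i j = 0.
Proof. exact: y_dy_g. Qed.

Lemma chern_y i j : \sum_k chern F a z i j k * z.2 0 k = nonlinear_connection F a z i j.
Proof. exact: (@chern_contract R Gi GX GY (z.2 0) (fiber_neq0 hA az) GY_sym GY_y y_GY). Qed.

Hypothesis D0 : \det (g_mx F a z) != 0.

Lemma derive_spray (f : E * E -> R) : differentiable (f : _ -> R^o) z ->
  'D_w (f : _ -> R^o) z = \sum_k z.2 0 k * dx k f z
    - \sum_i (\sum_j nonlinear_connection F a z i j * z.2 0 j) * dy i f z.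
Proof.
move=> df; rewrite derive_coord//=; congr (_ + _); rewrite -sumrN.
by apply: eq_bigr => i _; rewrite mxE mulNr.
Qed.

Let D0' : G 0 0 * G 1 1 - G 0 1 * G 1 0 != 0.
Proof. by rewrite -det_gE. Qed.
Let Gi00 : Gi 0 0 = G 1 1 / (G 0 0 * G 1 1 - G 0 1 * G 1 0).
Proof. by rewrite -det_gE; have [e _ _ _] := invmx2 D0; apply: (etrans e); rewrite mxE. Qed.
Let Gi01 : Gi 0 1 = - G 0 1 / (G 0 0 * G 1 1 - G 0 1 * G 1 0).
Proof. by rewrite -det_gE; have [_ e _ _] := invmx2 D0; apply: (etrans e); rewrite mxE. Qed.
Let Gi10 : Gi 1 0 = - G 1 0 / (G 0 0 * G 1 1 - G 0 1 * G 1 0).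
Proof. by rewrite -det_gE; have [_ _ e _] := invmx2 D0; apply: (etrans e); rewrite mxE. Qed.
Let Gi11 : Gi 1 1 = G 0 0 / (G 0 0 * G 1 1 - G 0 1 * G 1 0).
Proof. by rewrite -det_gE; have [_ _ _ e] := invmx2 D0; apply: (etrans e); rewrite mxE. Qed.

Lemma is_derive_det_g v : is_derive z v (fun z => \det (g_mx F a z) : R^o)
  (let D i j := 'D_v (fun z => g F a z i j : R^o) z in
   D 0 0 * G 1 1 + G 0 0 * D 1 1 - (D 0 1 * G 1 0 + G 0 1 * D 1 0) : R^o).
Proof.
pose h i j z : R^o := g F a z i j.
have dg i j : is_derive z v (h i j) ('D_v (h i j) z).
  exact: (diff_is_derive v (g_differentiable hA hF i j az)).
have h1 := is_deriveMo (dg 0 0) (dg 1 1).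
have h2 := is_deriveMo (dg 0 1) (dg 1 0).
have := is_deriveBo h1 h2.
by apply: near_eq_is_derive; near=> z'; rewrite /h det_gE.
Unshelve. all: by end_near. Qed.

Lemma derive_spray_det_g : 'D_w (fun z => \det (g_mx F a z) : R^o) z
  = 2 * \det (g_mx F a z) * \sum_i nonlinear_connection F a z i i.
Proof.
have [_ e] := is_derive_det_g w; apply: (etrans e) => {e}.
have e i j := derive_spray (g_differentiable hA hF i j az).
pose D i j := \sum_k z.2 0 k * GX k i j
    - \sum_m (\sum_j nonlinear_connection F a z m j * z.2 0 j) * GY m i j.
transitivity (D 0 0 * G 1 1 + G 0 0 * D 1 1 - (D 0 1 * G 1 0 + G 0 1 * D 1 0)).
  by congr (_ * _ + _ * _ - (_ * _ + _ * _)); exact: e.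
rewrite det_gE.
exact: (@spray_det R G Gi GX GY (z.2 0) (fiber_neq0 hA az)
  (fun i j => g_sym hA hF i j az) GX_sym GY_sym GY_y y_GY D0' Gi00 Gi01 Gi10 Gi11).
Qed.

Let double_half (x : R) : x = 2 * (2^-1 * x).
Proof. by field. Qed.

Lemma dx_dy_sq_FE m j : dx m (dy j L) z = 2 * \sum_k GX m j k * z.2 0 k.
Proof.
by apply: (etrans (double_half _)); congr (2 * _); exact: (esym (dx_g_y hA hF m j az)).
Qed.

Lemma dx_sq_FE m : dx m L z = \sum_i \sum_j GX m i j * z.2 0 i * z.2 0 j.
Proof.
have alg (gx : 'I_2 -> 'I_2 -> R) (y b : 'I_2 -> R) (d : R) :
    \sum_i y i * b i = 2 * d -> (forall i, b i = 2 * \sum_k gx i k * y k) ->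
    d = \sum_i \sum_j gx i j * y i * y j.
  by move=> e be; apply: (mulfI (lt0r_neq0 (ltr0Sn R 1))); rewrite -e !sum2E !be !sum2E; ring.
exact: (alg (GX m) (z.2 0) _ _ (dx_dy_sq_F_y hA hF m az) (dx_dy_sq_FE m)).
Qed.

Lemma dy_sq_FE i : dy i L z = 2 * \sum_k G i k * z.2 0 k.
Proof.
by apply: (etrans (double_half _)); congr (2 * _); exact: (esym (g_yr hA hF i az)).
Qed.

Lemma dy_dy_sq_FE i j : dy i (dy j L) z = 2 * G i j.
Proof.
by apply: (etrans (double_half _)); congr (2 * _); exact: (esym (gE a z i j)).
Qed.

Let S i := \sum_j nonlinear_connection F a z i j * z.2 0 j.

Let geodesic j : 2 * \sum_m G j m * S m
  = \sum_r \sum_s (2 * GX r j s - GX j r s) * z.2 0 r * z.2 0 s.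
Proof.
exact: (@spray_geodesic R G Gi GX GY (z.2 0) (fiber_neq0 hA az)
  (fun i j => g_sym hA hF i j az) GX_sym GY_sym GY_y y_GY D0' Gi00 Gi01 Gi10 Gi11).
Qed.

(** This is the Euler-Lagrange equation of the energy [L]: the equation [geodesic], once the
    derivatives of the metric contracted with [y] are recognized as derivatives of [L]. *)
Lemma derive_spray_dy_sq_F j : 'D_w (dy j L : _ -> R^o) z = dx j L z.
Proof.
rewrite (derive_spray (dy_sq_F_differentiable hA hF j az)) (dx_sq_FE j).
have alg (gx : 'I_2 -> 'I_2 -> 'I_2 -> R) (gg b c : 'I_2 -> 'I_2 -> R) (y s : 'I_2 -> R) :
    (forall i j, gg i j = gg j i) ->
    (forall m j, b m j = 2 * \sum_k gx m j k * y k) -> (forall i j, c i j = 2 * gg i j) ->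
    2 * \sum_m gg j m * s m = \sum_r \sum_s (2 * gx r j s - gx j r s) * y r * y s ->
    \sum_k y k * b k j - \sum_i s i * c i j = \sum_i \sum_k gx j i k * y i * y k.
  move=> gs be ce; rewrite !sum2E !be !ce (gs 0 j) (gs 1 j) !sum2E => e.
  by apply/eqP; rewrite subr_eq -subr_eq0; apply/eqP; move: e; lra.
exact: (alg GX G (fun m j => dx m (dy j L) z) (fun m j => dy m (dy j L) z) (z.2 0) S
  (fun i j => g_sym hA hF i j az) dx_dy_sq_FE dy_dy_sq_FE (geodesic j)).
Qed.

(** Conservation of energy. By symmetry of the metric, pairing [S] with the fibre gradient of [L]
    amounts to contracting the geodesic equation with [y]. *)
Lemma derive_spray_sq_F : 'D_w (L : _ -> R^o) z = 0.
Proof.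
rewrite (derive_spray (sq_F_differentiable hA hF az)).
have alg (gx : 'I_2 -> 'I_2 -> 'I_2 -> R) (gg : 'I_2 -> 'I_2 -> R) (b c y s : 'I_2 -> R) :
    (forall m i j, gx m i j = gx m j i) -> (forall i j, gg i j = gg j i) ->
    (forall m, b m = \sum_i \sum_j gx m i j * y i * y j) ->
    (forall i, c i = 2 * \sum_k gg i k * y k) ->
    (forall j, 2 * \sum_m gg j m * s m
      = \sum_r \sum_s (2 * gx r j s - gx j r s) * y r * y s) ->
    \sum_k y k * b k - \sum_i s i * c i = 0.
  move=> xs gs be ce e; have e0 := e 0; have e1 := e 1.
  rewrite !sum2E !be !ce !sum2E (gs 1 0).
  rewrite !sum2E ?(xs 0 1 0) ?(xs 1 1 0) in e0.
  rewrite !sum2E ?(xs 0 1 0) ?(xs 1 1 0) (gs 1 0) in e1.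
  have -> : s 0 * (2 * (gg 0 0 * y 0 + gg 0 1 * y 1)) + s 1 * (2 * (gg 0 1 * y 0 + gg 1 1 * y 1))
    = y 0 * (2 * (gg 0 0 * s 0 + gg 0 1 * s 1)) + y 1 * (2 * (gg 0 1 * s 0 + gg 1 1 * s 1)).
    by ring.
  by rewrite e0 e1 ?(xs 0 1 0) ?(xs 1 1 0); ring.
exact: (alg GX G (fun m => dx m L z) (fun i => dy i L z) (z.2 0) S GX_sym
  (fun i j => g_sym hA hF i j az) dx_sq_FE dy_sq_FE geodesic).
Qed.

End AtPoint.
End Spray.

Arguments spray {R M A} F a z.

(** * The forms omega1 and omega2 in coordinates *)

Section CoordinateForms.
Context {R : realType} {M : topologicalType} {A : charts 'rV[R]_2 M}.
Context (hA : smooth_atlas A) {F : M * 'rV[R]_2 -> R} (hF : finsler_metric A F).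
Notation E := 'rV[R]_2.
Notation TA := (tangent_charts A).
Implicit Types (a : chart_index A) (z u v : E * E) (i j k m : 'I_2).

(** The vector [v] is frozen while the point moves, that is, extended with constant components in
    the chart. For two such fields the exterior derivative has no bracket term. *)
Definition coord_omega1 a v z : R :=
  Num.sqrt (\det (g_mx F a z)) / loc_F F a z * (z.2 0 1 * v.1 0 0 - z.2 0 0 * v.1 0 1).

Definition coord_omega2 a v z : R := \sum_i dy i (loc_F F a) z * v.1 0 i.

Lemma coord_omega1Z a z r v v' : v'.1 = r *: v.1 ->
  coord_omega1 a v' z = r * coord_omega1 a v z.
Proof.
have alg (s x y b c : R) : s * (x * (r * b) - y * (r * c)) = r * (s * (x * b - y * c)).
  by ring.
by move=> e; rewrite /coord_omega1 e !mxE; exact: alg.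
Qed.

Lemma dy_loc_F_differentiable a j z : slit_image a z ->
  differentiable (dy j (loc_F F a) : _ -> R^o) z.
Proof. exact/smooth_differentiable/smooth_derive/(loc_F_smooth hF). Qed.

Section AtPoint.
Context (a : chart_index A) (z : E * E) (az : slit_image a z).
Notation f := (loc_F F a).
Notation L := (sq_F F a).
Notation w := (spray F a z).
Notation N := (nonlinear_connection F a z).

Lemma derive_sq_FE z' v : slit_image a z' ->
  'D_v (L : _ -> R^o) z' = 2 * (f z' * 'D_v (f : _ -> R^o) z').
Proof.
move=> az'; have d := diff_is_derive v (loc_F_differentiable hF az').
have [_ e] := is_deriveMo d d; apply: (etrans e); ring.
Qed.

Lemma derive_dy_sq_FE v j : 'D_v (dy j L : _ -> R^o) z
  = 2 * ('D_v (f : _ -> R^o) z * dy j f z + f z * 'D_v (dy j f : _ -> R^o) z).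
Proof.
rewrite (derive_near_slit hA (h := fun z => 2 * (f z * dy j f z)) v az); last first.
  by move=> z' az'; exact: derive_sq_FE.
have d := diff_is_derive v (loc_F_differentiable hF az).
have d' := diff_is_derive v (dy_loc_F_differentiable j az).
have [_ e] := is_deriveMo (is_derive_cst (2 : R^o) z v) (is_deriveMo d d').
by apply: (etrans e); rewrite mul0r add0r.
Qed.

Lemma is_derive_coord_omega2 u v : is_derive z u (coord_omega2 a v : _ -> R^o)
  (\sum_i 'D_u (dy i f : _ -> R^o) z * v.1 0 i : R^o).
Proof.
pose t i z : R^o := dy i f z * v.1 0 i.
have dt i : is_derive z u (t i) ('D_u (dy i f : _ -> R^o) z * v.1 0 i : R^o).
  have d := diff_is_derive u (dy_loc_F_differentiable i az).
  apply: (is_derive_eq (is_deriveMo d (is_derive_cst (v.1 0 i : R^o) z u))).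
  by rewrite mulr0 addr0.
apply: near_eq_is_derive (is_derive_sum dt).
by near=> x; rewrite fct_sumE.
Unshelve. all: by end_near. Qed.

Lemma derive_euler_loc_F u :
  \sum_i u.2 0 i * dy i f z + \sum_i z.2 0 i * 'D_u (dy i f : _ -> R^o) z
  = 'D_u (f : _ -> R^o) z.
Proof.
rewrite -(derive_fiber_contract (h := fun k => dy k f) u az); last first.
  by move=> k; exact: dy_loc_F_differentiable.
by apply: (derive_near_slit hA _ az) => z' az'; rewrite (euler_loc_F hA hF az').
Qed.

Hypothesis det_gt0 : 0 < \det (g_mx F a z).
Hypothesis f1 : f z = 1.

Let det0 : \det (g_mx F a z) != 0.
Proof. exact: lt0r_neq0. Qed.

Lemma derive_spray_loc_F : 'D_w (f : _ -> R^o) z = 0.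
Proof.
have := derive_spray_sq_F hA hF az det0.
by rewrite derive_sq_FE// f1 mul1r => /eqP; rewrite mulf_eq0 pnatr_eq0 /= => /eqP.
Qed.

(** The passage from the energy to the norm: [dy j L] is twice [f] times [dy j f], and the term in
    which the factor [f] is differentiated vanishes by conservation. *)
Lemma derive_spray_dy_loc_F j : 'D_w (dy j f : _ -> R^o) z = dx j f z.
Proof.
have := derive_spray_dy_sq_F hA hF az det0 j.
rewrite derive_dy_sq_FE derive_spray_loc_F mul0r add0r [X in _ = X]derive_sq_FE// f1 !mul1r.
by apply: mulfI; rewrite pnatr_eq0.
Qed.

(** Differentiating Euler's relation for [f] along [u] and subtracting the vertical part of the
    derivative of [f] leaves the horizontal part, the sum of [u.1 0 i * dx i f z]. The derivative
    along the spray gives the same sum by the Euler-Lagrange equation. *)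
Lemma dcoord_omega2_spray u :
  'D_u (coord_omega2 a w : _ -> R^o) z - 'D_w (coord_omega2 a u : _ -> R^o) z = 0.
Proof.
have [_ e1] := is_derive_coord_omega2 u w; have [_ e2] := is_derive_coord_omega2 w u.
transitivity (\sum_i 'D_u (dy i f : _ -> R^o) z * w.1 0 i
    - \sum_i 'D_w (dy i f : _ -> R^o) z * u.1 0 i).
  by congr (_ - _); [exact: e1|exact: e2].
have alg (b c d : R) : b + c = d + b -> c = d by lra.
have e := alg _ _ _ (etrans (derive_euler_loc_F u)
  (derive_coord u (loc_F_differentiable hF az))).
apply/eqP; rewrite subr_eq0; apply/eqP.
transitivity (\sum_i z.2 0 i * 'D_u (dy i f : _ -> R^o) z).
  by apply: eq_bigr => i _; rewrite mulrC.
by rewrite e; apply: eq_bigr => i _; rewrite derive_spray_dy_loc_F mulrC.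
Qed.

Lemma det_g_differentiable : differentiable (fun z => \det (g_mx F a z) : R^o) z.
Proof.
pose h i j z : R^o := g F a z i j.
have dh i j : differentiable (h i j) z by exact: (g_differentiable hA hF i j az).
have d1 := differentiableMo (dh 0 0) (dh 1 1).
have d2 := differentiableMo (dh 0 1) (dh 1 0).
apply: near_eq_differentiable (differentiableB d1 d2).
by near=> z'; rewrite /h [RHS]det_gE.
Unshelve. all: by end_near. Qed.

Let c z := Num.sqrt (\det (g_mx F a z)) / f z.

Lemma is_derive_density v : is_derive z v (c : _ -> R^o)
  ('D_v (fun z => \det (g_mx F a z) : R^o) z / (2 * Num.sqrt (\det (g_mx F a z)))
    - Num.sqrt (\det (g_mx F a z)) * 'D_v (f : _ -> R^o) z : R^o).
Proof.
have d1 := is_derive_sqrt v det_g_differentiable det_gt0.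
have df := loc_F_differentiable hF az.
have f0 : f z != 0 by rewrite f1 oner_eq0.
have d2 : is_derive z v (fun z => (f z)^-1 : R^o) (- 'D_v (f : _ -> R^o) z : R^o).
  have dv : differentiable (fun z => (f z)^-1 : R^o) z by exact: differentiableV.
  apply: (is_derive_eq (diff_is_derive v dv)).
  rewrite deriveV//; last exact: diff_derivable.
  by rewrite f1 expr1n invr1 scaleN1r.
apply: (is_derive_eq (is_deriveMo d1 d2)).
by rewrite f1 invr1 mulr1 mulrN.
Qed.

Lemma is_derive_coord_omega1 u v : is_derive z u (coord_omega1 a v : _ -> R^o)
  ('D_u (c : _ -> R^o) z * (z.2 0 1 * v.1 0 0 - z.2 0 0 * v.1 0 1)
    + c z * (u.2 0 1 * v.1 0 0 - u.2 0 0 * v.1 0 1) : R^o).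
Proof.
have [dc _] := is_derive_density u.
have d1 := derivableP dc.
have t i (b : R^o) : is_derive z u (fun z => fiber_coord i z * b : R^o) (u.2 0 i * b : R^o).
  apply: (is_derive_eq (is_deriveMo (is_derive_fiber_coord i z u) (is_derive_cst b z u))).
  by rewrite mulr0 addr0.
exact: (is_deriveMo d1 (is_deriveBo (t 1 (v.1 0 0)) (t 0 (v.1 0 1)))).
Qed.

Lemma derive_spray_density : 'D_w (c : _ -> R^o) z = c z * \sum_i N i i.
Proof.
have [_ ->] := is_derive_density w.
rewrite derive_spray_loc_F mulr0 subr0 derive_spray_det_g// /c f1 divr1.
have s0 : Num.sqrt (\det (g_mx F a z)) != 0 by rewrite sqrtr_eq0 -ltNge.
rewrite -{1}(sqr_sqrtr (ltW det_gt0)).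
move: (Num.sqrt _) (\sum_i _) s0 => s t s0; field; exact: s0.
Qed.

(** The derivative of the density along [u] drops out because [w.1 = y]. The remaining terms in [N]
    combine by the identity [tr N det(y, u) - det(N y, u) = det(y, N u)] for 2 by 2 matrices, with
    [u] standing for its base component. *)
Lemma dcoord_omega1_spray u :
  'D_w (coord_omega1 a u : _ -> R^o) z - 'D_u (coord_omega1 a w : _ -> R^o) z
  = coord_omega1 a (\row_i (u.2 0 i + \sum_j N i j * u.1 0 j), 0) z.
Proof.
have [_ e1] := is_derive_coord_omega1 w u; have [_ e2] := is_derive_coord_omega1 u w.
transitivity ('D_w (c : _ -> R^o) z * (z.2 0 1 * u.1 0 0 - z.2 0 0 * u.1 0 1)
    + c z * (w.2 0 1 * u.1 0 0 - w.2 0 0 * u.1 0 1)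
    - ('D_u (c : _ -> R^o) z * (z.2 0 1 * w.1 0 0 - z.2 0 0 * w.1 0 1)
    + c z * (u.2 0 1 * w.1 0 0 - u.2 0 0 * w.1 0 1))).
  by congr (_ - _); [exact: e1|exact: e2].
rewrite derive_spray_density /coord_omega1 -/(c z) /= !mxE !sum2E.
move: (c z) ('D_u _ z) (N) => s t n; ring.
Qed.

End AtPoint.
End CoordinateForms.

Arguments coord_omega1 {R M A} F a v z.
Arguments coord_omega2 {R M A} F a v z.

(** * Vectors on the tangent bundle under a change of chart *)

Section TangentTransition.
Context {R : realType} {M : topologicalType} {A : charts 'rV[R]_2 M}.
Context (hA : smooth_atlas A).
Notation E := 'rV[R]_2.
Notation TA := (tangent_charts A).
Implicit Types (a b : chart_index A) (z u v : E * E) (i j k m : 'I_2).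

Lemma derive_row_coord (V : normedModType R) (h : E -> V) (x y : E) :
  differentiable h x -> 'D_y h x = \sum_i y 0 i *: 'D_(evec i) h x.
Proof.
move=> dh; rewrite {1}(row2E y) derive_sumr//.
by apply: eq_bigr => i _; rewrite deriveZr.
Qed.

(** Each entry is a sum of fibre coordinates times partial derivatives of a smooth transition map at
    the base point, hence derivable. *)
Lemma tangent_transition_fiber_derivable a b z u : chart_image a (chart_dom b) z.1 ->
  derivable (fun z : E * E => 'D_(z.2) (transition a b) z.1) z u.
Proof.
move=> ax; pose h (j : 'I_2) z : R^o :=
  \sum_i fiber_coord i z * ('D_(evec i) (transition a b) z.1 0 j : R^o).
apply/derivable_mxP => i j; rewrite (ord1 i) => {i}.
have oU : open [set z : E * E | chart_image a (chart_dom b) z.1].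
  apply: (open_comp (f := fst)) (open_chart_image_dom hA a b).
  by move=> ? _; exact: cvg_fst.
have e : \near z, h j z = 'D_(z.2) (transition a b) z.1 0 j.
  apply: (open_near oU ax) => y ay; rewrite /h.
  rewrite (derive_row_coord y.2 (transition_differentiable hA ay)) summxE.
  by apply: eq_bigr => i _; rewrite mxE.
apply: (near_eq_derivable e).
pose t i z : R^o := fiber_coord i z * ('D_(evec i) (transition a b) z.1 0 j : R^o).
have dt i : derivable (t i) z u.
  have d0 : differentiable (fun x => 'D_(evec i) (transition a b) x) z.1.
    exact: (smooth_differentiable (smooth_derive (evec i) (@transition_smooth _ _ _ _ hA a b))).
  have d1 := differentiable_comp (differentiable_fst z) d0.
  have d2 := differentiable_comp d1 (differentiable_coord _ 0 j).
  by have [] := is_deriveMo (is_derive_fiber_coord i z u) (diff_is_derive u d2).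
apply: near_eq_derivable (derivable_sum dt).
by near=> x; rewrite fct_sumE.
Unshelve. all: by end_near. Qed.

Lemma is_derive_tangent_transition a b z u : chart_image a (chart_dom b) z.1 ->
  is_derive z u (transition (A := TA) a b)
    ('D_(u.1) (transition a b) z.1, 'D_u (fun z : E * E => 'D_(z.2) (transition a b) z.1) z).
Proof.
move=> ax.
have oU : open [set z : E * E | chart_image a (chart_dom b) z.1].
  apply: (open_comp (f := fst)) (open_chart_image_dom hA a b).
  by move=> ? _; exact: cvg_fst.
have d1 : is_derive z u (fun z : E * E => transition a b z.1) ('D_(u.1) (transition a b) z.1).
  have dt := transition_differentiable hA ax.
  have dc := differentiable_comp (differentiable_fst z) dt.
  have d := diff_is_derive u dc; apply: (is_derive_eq d).
  apply: (etrans (derive_comp u (differentiable_fst z) dt)).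
  by have [_ ->] := is_derive_fst z u.
have d2 := derivableP (@tangent_transition_fiber_derivable a b z u ax).
have d3 := is_derive_pair d1 d2.
have e : \near z, (transition a b z.1, 'D_(z.2) (transition a b) z.1)
    = transition (A := TA) a b z.
  by apply: (open_near oU ax) => y ay; rewrite (tangent_transition hA ay).
exact: near_eq_is_derive e d3.
Qed.

(** The base component is all that [omega1] and [omega2] see of a vector, so the second derivatives
    hidden in the fibre component never have to be computed. *)
Lemma tangent_vec_unchart1 a z u : chart_image a setT z.1 ->
  (vec_unchart (A := TA) a z u).1 = vec_unchart a z.1 u.1.
Proof.
move=> /(chart_image_chart_at hA) ax.
by have [_ e] := is_derive_tangent_transition u ax; exact: (congr1 fst e).
Qed.

Lemma jacobian_row a b x i j : chart_image a (chart_dom b) x ->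
  jacobian (transition a b) x i j = 'D_(evec i) (transition a b) x 0 j.
Proof.
by move=> ax; rewrite mxE deriveE//; exact: transition_differentiable.
Qed.

End TangentTransition.

Lemma oriented_smooth_atlas (R : realType) (M : topologicalType)
  (A : charts 'rV[R]_2 M) : oriented_surface A -> smooth_atlas A.
Proof. by case. Qed.

(** * Chart independence of the metric density and of the two forms *)

Section ChartChange.
Context {R : realType} {M : topologicalType} {A : charts 'rV[R]_2 M}.
Context (hM : oriented_surface A) {F : M * 'rV[R]_2 -> R} (hF : finsler_metric A F).
Notation E := 'rV[R]_2.
Notation TA := (tangent_charts A).
Implicit Types (z u v : E * E) (i j k m : 'I_2).

Let hA := oriented_smooth_atlas hM.

(** Linearity of [J] makes the two difference quotients coincide for every increment, so their
    limits coincide as well. *)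
Lemma derive_fiber_pair (fa fb : E * E -> R) (x x' v y : E) (J : E -> E) :
  (forall (r : R) (v w : E), J (r *: v + w) = r *: J v + J w) ->
  (forall y, fa (x, y) = fb (x', J y)) ->
  'D_(0, v) (fa : _ -> R^o) (x, y) = 'D_(0, J v) (fb : _ -> R^o) (x', J y).
Proof.
move=> Jl fab; rewrite /derive; apply: (congr1 (fun d : R -> R^o => lim (d @ 0^'))).
apply/funext => h /=; rewrite fab; congr (_ *: (_ - _)).
transitivity (fa (x, h *: v + y)); first by congr fa; congr (_, _); rewrite /= scaler0 add0r.
by rewrite fab Jl; congr fb; congr (_, _); rewrite /= scaler0 add0r.
Qed.

Lemma derive_fiber (fa fb : E * E -> R) z1 z2 (v : E) (J : E -> E) :
  (forall (r : R) (v w : E), J (r *: v + w) = r *: J v + J w) ->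
  (forall y, fa (z1.1, y) = fb (z2.1, J y)) -> z2.2 = J z1.2 ->
  'D_(0, v) (fa : _ -> R^o) z1 = 'D_(0, J v) (fb : _ -> R^o) z2.
Proof.
by case: z1 z2 => x y [x' y'] /= Jl fab ->; exact: derive_fiber_pair.
Qed.

Section AtPoint.
Context (a : chart_index A) (z : E * E) (az : slit_image a z).
Let p := unchart a z.1.
Let b := chart_at A p.
Let J := vec_unchart a z.1.
Let z' : E * E := (chart_map b p, J z.2).

Let ax : chart_image a setT z.1.
Proof. by have /(slit_imageP hA)[] := az. Qed.

Let Jl (r : R) (v w : E) : J (r *: v + w) = r *: J v + J w.
Proof. exact: (vec_unchart_lin hA ax). Qed.

Let Jcoord y k : J y 0 k = \sum_i y 0 i * J (evec i) 0 k.
Proof.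
rewrite /J /vec_unchart derive_row_coord; last first.
  exact/(transition_differentiable hA)/(chart_image_chart_at hA ax).
by rewrite summxE; apply: eq_bigr => i _; rewrite mxE.
Qed.

Let bz' : slit_image b z'.
Proof.
apply/(slit_imageP hA); split=> /=.
  by apply: chart_image_mem => //; exact: (chart_at_dom hA).
by rewrite (vec_unchart_eq0 hA z.2 ax); have /(slit_imageP hA)[] := az.
Qed.

Let loc_FE y : loc_F F a (z.1, y) = loc_F F b (z'.1, J y).
Proof.
rewrite /loc_F /= (unchartK hA (chart_at_dom hA p)).
by rewrite (vec_unchart_id hA p).
Qed.

Let sq_FE y : sq_F F a (z.1, y) = sq_F F b (z'.1, J y).
Proof. by rewrite /sq_F loc_FE. Qed.

(** [J] is the differential of the chart change at the base point and is constant along the fibre.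
    Second fibre derivatives of the energy therefore transform as a bilinear form, without
    correction terms. *)
Lemma g_chart_change i j : g F a z i j =
  \sum_k J (evec j) 0 k * (\sum_l J (evec i) 0 l * g F b z' l k).
Proof.
have e1 y : 'D_(0, evec j) (sq_F F a : _ -> R^o) (z.1, y)
    = 'D_(0, J (evec j)) (sq_F F b : _ -> R^o) (z'.1, J y).
  exact: (@derive_fiber_pair (sq_F F a) (sq_F F b) z.1 z'.1 (evec j) y J Jl sq_FE).
have e2 : dy i (dy j (sq_F F a)) z
    = 'D_(0, J (evec i)) (fun z => 'D_(0, J (evec j)) (sq_F F b : _ -> R^o) z : R^o) z'.
  exact: (@derive_fiber (dy j (sq_F F a))
    (fun z => 'D_(0, J (evec j)) (sq_F F b : _ -> R^o) z) z z' (evec i) J Jl e1 erefl).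
have e3 x : slit_image b x -> 'D_(0, J (evec j)) (sq_F F b : _ -> R^o) x
    = \sum_k J (evec j) 0 k * dy k (sq_F F b) x.
  move=> bx; have dF := sq_F_differentiable hA hF bx.
  exact: (@derive_vertical R (sq_F F b) x (J (evec j)) dF).
rewrite gE e2 (derive_near_slit hA _ bz' e3).
pose t k x : R^o := J (evec j) 0 k * dy k (sq_F F b) x.
have dt k : is_derive z' (0, J (evec i)) (t k)
    (J (evec j) 0 k * \sum_l J (evec i) 0 l * dy l (dy k (sq_F F b)) z' : R^o).
  have dd := dy_sq_F_differentiable hA hF k bz'.
  apply: (is_derive_eq (is_deriveMo (is_derive_cst (J (evec j) 0 k : R^o) z' (0, J (evec i)))
    (diff_is_derive _ dd))).
  by rewrite mul0r add0r (derive_vertical _ dd).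
have e4 := derive_val (is_derive := is_derive_sum dt).
transitivity (2^-1 * 'D_(0, J (evec i)) (\sum_k t k) z').
  congr (_ * _); apply: near_eq_derive.
  by near=> x; rewrite fct_sumE.
rewrite e4 mulr_sumr; apply: eq_bigr => k _; rewrite mulrCA; congr (_ * _).
by rewrite mulr_sumr; apply: eq_bigr => l _; rewrite mulrCA.
Unshelve. all: by end_near. Qed.

Let d := J (evec 0) 0 0 * J (evec 1) 0 1 - J (evec 0) 0 1 * J (evec 1) 0 0.

Let d_gt0 : 0 < d.
Proof.
have [_ _ _ /(_ a b p)] := hM.
have /(chart_imageP hA)[dx _ xE] := ax.
rewrite xE det2 !(jacobian_row hA); try exact: (chart_image_chart_at hA ax).
by apply => //; exact: (chart_at_dom hA).
Qed.

Lemma det_g_chart_change : \det (g_mx F a z) = d ^+ 2 * \det (g_mx F b z').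
Proof.
have alg (ga gb c : 'I_2 -> 'I_2 -> R) :
    (forall i j, ga i j = \sum_k c j k * (\sum_l c i l * gb l k)) ->
    ga 0 0 * ga 1 1 - ga 0 1 * ga 1 0 =
    (c 0 0 * c 1 1 - c 0 1 * c 1 0) ^+ 2 * (gb 0 0 * gb 1 1 - gb 0 1 * gb 1 0).
  by move=> e; rewrite !e !sum2E; ring.
apply: (etrans (det_gE a z)).
apply: (etrans (alg (g F a z) (g F b z') (fun i k => J (evec i) 0 k) g_chart_change)).
by congr (_ * _); exact: (esym (det_gE b z')).
Qed.

Let chart_mapE : chart_map (c := TA) b (unchart (c := TA) a z) = z'.
Proof. by congr (_, _); rewrite /= -/p (vec_coord_id hA). Qed.

Let local_omega1_fiber u :
  local_form (A := TA) (omega1 A F) a z u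
    = Num.sqrt (\det (g_mx F b z')) / loc_F F a z
      * (J z.2 0 1 * J u.1 0 0 - J z.2 0 0 * J u.1 0 1).
Proof.
rewrite /local_form /omega1 -[chart_at A _]/b chart_mapE.
by rewrite (tangent_vec_unchart1 hA u ax).
Qed.

(** The root of the determinant of the metric in the chart [a] is [d] times that in the preferred
    chart, while the area form evaluated on the components in [a] is smaller by the same factor. The
    root of [d ^+ 2] is [d] because the atlas is oriented. *)
Lemma local_omega1 u : local_form (A := TA) (omega1 A F) a z u = coord_omega1 F a u z.
Proof.
have sE : Num.sqrt (\det (g_mx F a z)) = d * Num.sqrt (\det (g_mx F b z')).
  apply: (etrans (congr1 Num.sqrt det_g_chart_change)).
  by rewrite sqrtrM ?sqr_ge0// sqrtr_sqr gtr0_norm.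
apply: (etrans (local_omega1_fiber u)).
transitivity (d * Num.sqrt (\det (g_mx F b z')) / loc_F F a z
   * (z.2 0 1 * u.1 0 0 - z.2 0 0 * u.1 0 1)); last first.
  by congr (_ / _ * _); exact: (esym sE).
have alg (c : 'I_2 -> 'I_2 -> R) (y v y' v' : 'I_2 -> R) (s t : R) :
    (forall k, y' k = \sum_i y i * c i k) -> (forall k, v' k = \sum_i v i * c i k) ->
    s / t * (y' 1 * v' 0 - y' 0 * v' 1)
    = (c 0 0 * c 1 1 - c 0 1 * c 1 0) * s / t * (y 1 * v 0 - y 0 * v 1).
  by move=> ye ve; rewrite !ye !ve !sum2E; move: t^-1 => r; ring.
exact: (alg (fun i k => J (evec i) 0 k) (z.2 0) (u.1 0) (J z.2 0) (J u.1 0) _ _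
  (Jcoord z.2) (Jcoord u.1)).
Qed.

Lemma local_omega2 u : local_form (A := TA) (omega2 A F) a z u = coord_omega2 F a u z.
Proof.
rewrite /local_form /omega2 -[chart_at A _]/b chart_mapE.
rewrite (tangent_vec_unchart1 hA u ax) -[vec_unchart a z.1 u.1]/(J u.1).
transitivity ('D_(0, J u.1) (loc_F F b : _ -> R^o) z').
  rewrite (derive_vertical _ (loc_F_differentiable hF bz')).
  by apply: eq_bigr => i _; rewrite mulrC.
apply: (etrans (esym (@derive_fiber (loc_F F a) (loc_F F b) z z' u.1 J Jl loc_FE erefl))).
rewrite (derive_vertical _ (loc_F_differentiable hF az)).
by apply: eq_bigr => i _; rewrite mulrC.
Qed.

End AtPoint.
End ChartChange.

(** * Integral elements *)

Section Indicatrix.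
Context {R : realType} {M : topologicalType} {A : charts 'rV[R]_2 M}.
Context (hM : oriented_surface A) {F : M * 'rV[R]_2 -> R} (hF : finsler_metric A F).
Notation E := 'rV[R]_2.
Notation TA := (tangent_charts A).
Notation ZA := (line_charts TA).

Let hA := oriented_smooth_atlas hM.

Lemma finsler_zero p : F (p, 0) = 0.
Proof.
have [_ _ hom _] := hF; have := hom p 0 2 (ltr0Sn R 1); rewrite scaler0 => e.
by lra.
Qed.

Lemma Sigma_slit xi : Sigma F xi -> slit xi.
Proof.
case: xi => p y; rewrite /Sigma /slit /= => Fxi; apply/eqP => y0.
by move: Fxi; rewrite y0 finsler_zero => /eqP; rewrite eq_sym oner_eq0.
Qed.

Lemma tangent_unchartK (a : chart_index A) (xi : M * E) : chart_dom a xi.1 ->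
  unchart (c := TA) a (chart_map (c := TA) a xi) = xi.
Proof.
case: xi => p y ap; congr (_, _); rewrite /= ?(unchartK hA ap)//.
by rewrite (vec_coordK hA).
Qed.

Lemma slit_image_chart_map (a : chart_index A) (xi : M * E) : chart_dom a xi.1 -> slit xi ->
  slit_image a (chart_map (c := TA) a xi).
Proof. by move=> ap sxi; exists xi. Qed.

Lemma loc_F_chart_map (a : chart_index A) (xi : M * E) : chart_dom a xi.1 ->
  loc_F F a (chart_map (c := TA) a xi) = F xi.
Proof. by move=> ap; rewrite /loc_F tangent_unchartK. Qed.

Lemma det_g_gt0 p (y : E) : y != 0 ->
  0 < \det (g_mx F (chart_at A p) (chart_map (c := TA) (chart_at A p) (p, y))).
Proof.
move=> y0; have [_ _ _ pos] := hF.
have alg (G : 'I_2 -> 'I_2 -> R) : G 0 1 = G 1 0 ->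
    (forall U : E, U != 0 -> 0 < \sum_i \sum_j G i j * U 0 i * U 0 j) ->
    0 < G 0 0 * G 1 1 - G 0 1 * G 1 0.
  move=> sG posG.
  have g0 : 0 < G 0 0.
    have := posG (evec 0); rewrite !sum2E !mxE /= !(mulr1, mulr0, addr0); apply.
    by apply/eqP => /rowP/(_ 0); rewrite !mxE /= => /eqP; rewrite oner_eq0.
  (* On the vector [(- G 0 1, G 0 0)], which is orthogonal to the first basis vector, the quadratic
     form equals [G 0 0] times the determinant. *)
  have := posG (\row_i (if i == 0 then - G 0 1 else G 0 0)).
  rewrite !sum2E !mxE /= -sG => h.
  rewrite -(pmulr_rgt0 _ g0).
  have /h : \row_i (if i == 0 then - G 0 1 else G 0 0) != 0 :> E.
    by apply/eqP => /rowP/(_ 1); rewrite !mxE /= => /eqP; rewrite gt_eqF.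
  by congr (0 < _); ring.
rewrite det_gE; apply: alg; last by move=> U U0; exact: (pos p y U y0 U0).
apply: (g_sym hA hF); apply: (slit_image_chart_map (xi := (p, y))) => //.
exact: (chart_at_dom hA).
Qed.

Section AtPoint.
Context (xi : M * E) (Sxi : Sigma F xi).
Let a := chart_at A xi.1.
Let z := chart_map (c := TA) a xi.
Implicit Types u v : E * E.

Let axi : chart_dom a xi.1. Proof. exact: (chart_at_dom hA). Qed.
Let az : slit_image a z.
Proof. exact: (slit_image_chart_map axi (Sigma_slit Sxi)). Qed.
Let f1 : loc_F F a z = 1.
Proof. by rewrite /z loc_F_chart_map. Qed.
Let detg : 0 < \det (g_mx F a z).
Proof. by have := det_g_gt0 xi.1 (Sigma_slit Sxi); rewrite -surjective_pairing. Qed.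

Lemma omega1_coord u : omega1 A F xi u = coord_omega1 F a u z.
Proof. by rewrite /coord_omega1 f1 -Sxi. Qed.

Lemma omega2_coord u : omega2 A F xi u = coord_omega2 F a u z.
Proof. by []. Qed.

Lemma dform_omega1 u v : dform TA (omega1 A F) xi u v =
  'D_u (coord_omega1 F a v : _ -> R^o) z - 'D_v (coord_omega1 F a u : _ -> R^o) z.
Proof.
have e t (x : E * E) : slit_image a x ->
    local_form (A := TA) (omega1 A F) a x t = coord_omega1 F a t x.
  by move=> ax; exact: local_omega1.
by congr (_ - _); exact: (derive_near_slit hA _ az (e _)).
Qed.

Lemma dform_omega2 u v : dform TA (omega2 A F) xi u v =
  'D_u (coord_omega2 F a v : _ -> R^o) z - 'D_v (coord_omega2 F a u : _ -> R^o) z.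
Proof.
have e t (x : E * E) : slit_image a x ->
    local_form (A := TA) (omega2 A F) a x t = coord_omega2 F a t x.
  by move=> ax; exact: local_omega2.
by congr (_ - _); exact: (derive_near_slit hA _ az (e _)).
Qed.

Let w := spray F a z.

Lemma tangent_SigmaE u : tangent_Sigma A F xi u <-> 'D_u (loc_F F a : _ -> R^o) z = 0.
Proof. by []. Qed.

Lemma omega1_spray : omega1 A F xi w = 0.
Proof. by rewrite omega1_coord /coord_omega1 /w /= mulrC [X in X - _]mulrC subrr mul0r. Qed.

Lemma omega2_spray : omega2 A F xi w = 1.
Proof.
rewrite omega2_coord -f1 -(euler_loc_F hA hF az).
by apply: eq_bigr => i _; rewrite mulrC.
Qed.

Lemma tangent_spray : tangent_Sigma A F xi w.
Proof. exact: (derive_spray_loc_F hA hF az detg f1). Qed.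

Section Structure.
Context {omega3 : M * E -> E * E -> R} {cI cJ cK : M * E -> R}.
Context (hstr : structure_equations A F omega3 cI cJ cK).

(* Contracting d omega2 with the geodesic spray shows that omega3 vanishes on it;
   then omega3 is read off the contraction of d omega1. *)
Lemma omega3_coord u : tangent_Sigma A F xi u -> omega1 A F xi u != 0 ->
  omega2 A F xi u = 0 ->
  omega3 xi u = coord_omega1 F a
    (\row_i (u.2 0 i + \sum_j nonlinear_connection F a z i j * u.1 0 j), 0) z.
Proof.
move=> tu u1 u2; have [_ _ _ str] := hstr.
have [_ e2 _] := str xi u w Sxi tu tangent_spray.
have [e1 _ _] := str xi w u Sxi tangent_spray tu.
rewrite dform_omega2 (dcoord_omega2_spray hA hF az detg f1) in e2.
rewrite dform_omega1 (dcoord_omega1_spray hA hF az detg f1) in e1.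
rewrite e1.
move: e2; rewrite /wedge11 omega1_spray omega2_spray u2 => e2.
have -> : omega3 xi w = 0 by apply: (mulfI u1); move: e2; lra.
by ring.
Qed.

(** The vector is the fibre gradient of the norm turned by a right angle, so it is tangent to the
    indicatrix in its fibre. If [omega3] vanished on it as well, the coframe property would make the
    gradient zero, contradicting Euler's relation at norm 1. *)
Lemma vertical_tangent : exists v, [/\ tangent_Sigma A F xi v,
  omega1 A F xi v = 0, omega2 A F xi v = 0 & omega3 xi v != 0].
Proof.
have [_ _ inj _] := hstr.
pose v : E * E := (0, \row_i (if i == 0 then - dy 1 (loc_F F a) z else dy 0 (loc_F F a) z)).
have v1 : omega1 A F xi v = 0.
  by rewrite omega1_coord /coord_omega1 /= !mxE; ring.
have v2 : omega2 A F xi v = 0.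
  by rewrite omega2_coord /coord_omega2 big1// => i _; rewrite mxE mulr0.
have tv : tangent_Sigma A F xi v.
  apply/tangent_SigmaE; rewrite /v (derive_vertical _ (loc_F_differentiable hF az)).
  have alg (b c : R) : - c * b + b * c = 0 by ring.
  by rewrite sum2E !mxE /=; exact: alg.
exists v; split=> //; apply/eqP => v3.
have /(congr1 snd) /= /rowP ve := inj xi v Sxi tv v1 v2 v3.
have := euler_loc_F hA hF az; rewrite f1 sum2E.
have := ve 0; have := ve 1; rewrite !mxE /= => -> /eqP; rewrite oppr_eq0 => /eqP ->.
by rewrite !mulr0 addr0 => /eqP; rewrite eq_sym oner_eq0.
Qed.

Lemma omega1_0 : omega1 A F xi 0 = 0.
Proof. by rewrite omega1_coord /coord_omega1 /= !mxE; ring. Qed.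

Lemma omega2_0 : omega2 A F xi 0 = 0.
Proof. by rewrite omega2_coord /coord_omega2 big1// => i _; rewrite mxE mulr0. Qed.

Lemma omega3_0 : omega3 xi 0 = 0.
Proof.
have [[lin3 _] _ _ _] := hstr.
have := lin3 xi (Sigma_slit Sxi) (-1) 0 0; rewrite scaler0 addr0 => ->.
by rewrite scaleN1r addNr.
Qed.

Lemma tangent_Sigma0 : tangent_Sigma A F xi 0.
Proof. by apply/tangent_SigmaE; rewrite derive0. Qed.

Lemma line_vec_unchart (x v : (E * E) * R^o) : slit_image a x.1 ->
  (vec_unchart (A := ZA) a x v).1 = vec_unchart (A := TA) a x.1 v.1.
Proof.
move=> /(slit_imageP hA)[ax _].
set b := chart_at A (unchart a x.1.1).
have [c e] := is_derive_tangent_transition hA v.1 (chart_image_chart_at hA ax).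
have d := is_derive_comp_fst (x := x) (v := v) (derivableP c).
have [_ e'] := is_derive_pair d (is_derive_snd x v).
exact: (congr1 fst e').
Qed.

Lemma local_psi (x v : (E * E) * R^o) : slit_image a x.1 ->
  local_form (A := ZA) (psi A F) a x v
  = coord_omega1 F a v.1 x.1 + x.2 * coord_omega2 F a v.1 x.1.
Proof.
move=> ax; rewrite -(local_omega1 hM hF ax) -(local_omega2 hM hF ax).
by rewrite /local_form /psi line_vec_unchart.
Qed.

(** The last bracket is [d lambda /\ omega2]; the other terms come from differentiating with
    [lambda] held fixed. *)
Lemma PsiE (lam : R) (u v : (E * E) * R^o) : Psi A F (xi, lam) u v =
  dform TA (omega1 A F) xi u.1 v.1 + lam * dform TA (omega2 A F) xi u.1 v.1
  + (u.2 * omega2 A F xi v.1 - v.2 * omega2 A F xi u.1).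
Proof.
have e (s t : (E * E) * R^o) :
    'D_s ((fun x => local_form (A := ZA) (psi A F) a x t) : _ -> R^o) (z, lam : R^o)
    = 'D_(s.1) (coord_omega1 F a t.1 : _ -> R^o) z
      + (s.2 * omega2 A F xi t.1 + lam * 'D_(s.1) (coord_omega2 F a t.1 : _ -> R^o) z).
  have oU : open [set x : (E * E) * R^o | slit_image a x.1].
    apply: (open_comp (f := fst)) (@open_slit_image _ _ _ hA a).
    by move=> ? _; exact: cvg_fst.
  have [c1 _] := is_derive_coord_omega1 hA hF az detg f1 s.1 t.1.
  have [c2 _] := is_derive_coord_omega2 hF az s.1 t.1.
  have d1 := is_derive_comp_fst (x := (z, lam : R^o)) (v := s) (derivableP c1).
  have d2 := is_derive_comp_fst (x := (z, lam : R^o)) (v := s) (derivableP c2).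
  have d3 := is_deriveMo (is_derive_snd (z, lam : R^o) s) d2.
  have := @is_deriveD _ _ _ _ _ _ _ _ _ d1 d3.
  move=> [_ <-]; apply: near_eq_derive.
  by apply: (open_near oU) => // x ax; exact: local_psi.
have alg (x1 x2 y1 y2 l p q : R) :
    (x1 + (p + l * y1)) - (x2 + (q + l * y2)) = (x1 - x2) + l * (y1 - y2) + (p - q) by ring.
rewrite (dform_omega1 u.1 v.1) (dform_omega2 u.1 v.1); apply: (etrans _ (alg _ _ _ _ _ _ _)).
by congr (_ - _); [exact: (e u v)|exact: (e v u)].
Qed.

(** Three test vectors extract the conditions, each using the previous ones: the direction of
    [lambda] gives [omega2 = 0], the vertical direction gives [lambda = - I] because [omega1] is
    nonzero on [v], and the spray gives the value of [omega3]. *)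
Lemma integral_elementP (lam : R) (v : (E * E) * R^o) : tangent_Sigma A F xi v.1 ->
  integral_element A F (xi, lam) v <->
  [/\ omega1 A F xi v.1 <> 0, lam = - cI xi, omega2 A F xi v.1 = 0 & omega3 xi v.1 = v.2].
Proof.
move=> tv; have [_ _ _ str] := hstr.
have PE (u : (E * E) * R^o) : tangent_Sigma A F xi u.1 -> Psi A F (xi, lam) u v
    = - (cI xi + lam) * wedge11 (omega1 A F xi) (omega3 xi) u.1 v.1
      + wedge11 (omega2 A F xi) (omega3 xi) u.1 v.1
      + (u.2 * omega2 A F xi v.1 - v.2 * omega2 A F xi u.1).
  by move=> tu; rewrite PsiE; have [-> -> _] := str xi u.1 v.1 Sxi tu tv; ring.
split=> [[car v1]|[v1 lamE v2 v3]].
  have P0 (u : (E * E) * R^o) : tangent_Sigma A F xi u.1 -> Psi A F (xi, lam) u v = 0.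
    by move=> tu; apply: car; exists u.
  have v2 : omega2 A F xi v.1 = 0.
    have := P0 (0, 1 : R^o) tangent_Sigma0.
    rewrite PE; last exact: tangent_Sigma0.
    by rewrite /wedge11 omega1_0 omega2_0 omega3_0 /=; lra.
  have lamE : lam = - cI xi.
    have [x [tx x1 x2 x3]] := vertical_tangent.
    have := P0 (x, 0 : R^o) tx; rewrite PE// /wedge11 /= x1 x2 v2 => e.
    have nz : omega1 A F xi v.1 * omega3 xi x != 0 by rewrite mulf_neq0//; exact/eqP.
    have : (cI xi + lam) * (omega1 A F xi v.1 * omega3 xi x) = 0 by move: e; lra.
    by move=> /eqP; rewrite mulf_eq0 (negPf nz) orbF => /eqP; lra.
  split=> //; have := P0 (w, 0 : R^o) tangent_spray.
  rewrite PE; last exact: tangent_spray.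
  by rewrite /wedge11 /= omega1_spray omega2_spray v2 lamE; lra.
by split=> // _ [u tu ->]; rewrite PE// lamE /wedge11 v2 v3; ring.
Qed.

End Structure.
End AtPoint.
End Indicatrix.

(** * The normal lift *)

Section Curves.
Context {R : realType} {E : normedModType R} {X : Type} (A : charts E X).

Lemma velocityE (c : R -> X) t :
  velocity A c t = 'D_1 (chart_map (chart_at A (c t)) \o c : R^o -> E) t.
Proof. exact: derive1E. Qed.

Lemma smooth_curve_differentiable D (c : R -> X) t : smooth_curve A D c -> D t ->
  chart_dom (chart_at A (c t)) (c t) ->
  differentiable (chart_map (chart_at A (c t)) \o c : R^o -> E) t.
Proof.
move=> sc Dt ct; have [_ sm] := sc (chart_at A (c t)).
exact: (smooth_differentiable sm).
Qed.

(** The chart properties are hypotheses here because [smooth_atlas] refers to a topology on [X],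
    whereas the tangent bundle is handled through its charts alone. *)
Lemma derive_along_curve D (c : R -> X) (f : X -> R) t : smooth_curve A D c -> D t ->
  (forall p, chart_dom (chart_at A p) p) ->
  (forall (a : chart_index A) p, chart_dom a p -> unchart a (chart_map a p) = p) ->
  differentiable (f \o unchart (chart_at A (c t)) : E -> R^o)
    (chart_map (chart_at A (c t)) (c t)) ->
  is_derive t 1 (f \o c : R^o -> R^o) (dfun A f (c t) (velocity A c t) : R^o).
Proof.
move=> sc Dt cd uK df; set a := chart_at A (c t) in df *.
have dc : differentiable (chart_map a \o c : R^o -> E) t.
  by apply: smooth_curve_differentiable sc Dt _; exact: cd.
have [oD _] := sc a.
have e : \forall r \near (t : R^o), ((f \o unchart a) \o (chart_map a \o c)) r = (f \o c) r.
  by apply: (open_near oD); [split=> //; exact: cd|move=> r [_ ar] /=; rewrite uK].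
have dd := differentiable_comp dc df.
have d1 := diff_is_derive (1 : R^o) dd.
have d2 := near_eq_is_derive e d1.
apply: (is_derive_eq d2).
apply: (etrans (derive_comp (1 : R^o) dc df)).
by rewrite /dfun velocityE.
Qed.

End Curves.

Section Lift.
Context {R : realType} {M : topologicalType} {A : charts 'rV[R]_2 M}.
Context (hM : oriented_surface A) {F : M * 'rV[R]_2 -> R} (hF : finsler_metric A F).
Notation E := 'rV[R]_2.
Notation TA := (tangent_charts A).
Notation ZA := (line_charts TA).
Let hA := oriented_smooth_atlas hM.

(** Contracting the metric with [y] gives half the fibre gradient of the squared norm. This
    translates the two conditions on [N] into the lift lying on the indicatrix bundle and being
    annihilated by [omega2]. *)
Lemma g_inner_self p (y U : E) : y != 0 ->
  g_inner A F p y y U = F (p, y) * omega2 A F (p, y) (U, 0).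
Proof.
move=> y0; rewrite /g_inner /omega2.
set a := chart_at A p; set z := chart_map (c := TA) a (p, y).
have ap : chart_dom a p by exact: (chart_at_dom hA).
have az : slit_image a z by exact: (@slit_image_chart_map _ _ _ a (p, y) ap y0).
have zy : z.2 = y by exact: (vec_coord_id hA).
have FE : loc_F F a z = F (p, y) by exact: (@loc_F_chart_map _ _ _ hM F a (p, y) ap).
have alg (G : 'I_2 -> 'I_2 -> R) (x v c : 'I_2 -> R) f :
    (forall j, \sum_k G k j * x k = 2^-1 * (2 * (f * c j))) ->
    \sum_i \sum_j G i j * x i * v j = f * \sum_i c i * v i.
  move=> e; have e0 := e 0; have e1 := e 1; rewrite !sum2E in e0 e1 *.
  transitivity ((G 0 0 * x 0 + G 1 0 * x 1) * v 0 + (G 0 1 * x 0 + G 1 1 * x 1) * v 1).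
    by ring.
  by rewrite e0 e1; field.
apply: alg => j; rewrite -FE -(derive_sq_FE hF (0, evec j) az) -zy.
exact: (g_yl hA hF j az).
Qed.

Lemma omega2_self p (y : E) : y != 0 -> omega2 A F (p, y) (y, 0) = F (p, y).
Proof.
move=> y0; rewrite /omega2.
set a := chart_at A p; set z := chart_map (c := TA) a (p, y).
have ap : chart_dom a p by exact: (chart_at_dom hA).
have az : slit_image a z by exact: (@slit_image_chart_map _ _ _ a (p, y) ap y0).
have zy : z.2 = y by exact: (vec_coord_id hA).
rewrite -(@loc_F_chart_map _ _ _ hM F a (p, y) ap) -/z -(euler_loc_F hA hF az) zy.
by apply: eq_bigr => i _; rewrite mulrC.
Qed.

Lemma tangent_unchart_at (xi : M * E) : chart_dom (chart_at TA xi) xi.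
Proof. exact: (chart_at_dom hA). Qed.

Lemma slit_fun_differentiable (f : M * E -> R) (xi : M * E) :
  smooth_fun TA slit f -> slit xi ->
  differentiable (f \o unchart (chart_at TA xi) : E * E -> R^o)
    (chart_map (chart_at TA xi) xi).
Proof.
move=> sf sxi; apply: (smooth_differentiable (sf (chart_at TA xi))).
exact: (slit_image_chart_map (tangent_unchart_at xi) sxi).
Qed.

Context {D : set R} (hDopen : open D).
Context {gamma : R -> M} {N : R -> E} (hN : normal_lift A F D gamma N).
Let h := field_lift gamma N.
Let V t := velocity TA h t.

Lemma lift_neq0 t : D t -> N t != 0.
Proof.
move=> Dt; have [_ _ _ NN _] := hN; apply/eqP => N0.
have := NN t Dt; rewrite N0 /g_inner big1 => [/eqP|i _]; first by rewrite eq_sym oner_eq0.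
by rewrite big1// => j _; rewrite [(0 : E) 0 j]mxE mulr0.
Qed.

Lemma lift_Sigma t : D t -> Sigma F (h t).
Proof.
move=> Dt; have [_ _ _ NN _] := hN; have [F0 _ _ _] := hF.
have := NN t Dt; rewrite g_inner_self ?lift_neq0// omega2_self ?lift_neq0// => FF.
by apply/eqP; rewrite -(@eqrXn2 _ 2)// ?expr1n// expr2 FF.
Qed.

Let sh : smooth_curve TA D h. Proof. by case: hN. Qed.

Let dh t : D t -> differentiable (chart_map (chart_at TA (h t)) \o h : R^o -> (E * E)%type) t.
Proof.
by move=> Dt; apply: smooth_curve_differentiable sh Dt _; exact: tangent_unchart_at.
Qed.

Lemma lift_velocity1 t : D t -> (V t).1 = velocity A gamma t.
Proof.
move=> Dt; rewrite /V !velocityE.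
have dc := dh Dt; set c := _ \o h in dc *.
transitivity ('D_1 (fst \o c : R^o -> E) t); last by [].
rewrite derive_comp//; last exact: differentiable_fst.
by have [_ ->] := is_derive_fst (c t) ('D_1 c t).
Qed.

Lemma lift_velocity2 t i : D t ->
  (V t).2 0 i = derive1 (fun r => vec_coord (chart_at A (gamma t)) (gamma r) (N r) 0 i) t.
Proof.
move=> Dt; rewrite /V velocityE derive1E.
have dc := dh Dt; set c := _ \o h in dc *.
transitivity ('D_1 (fiber_coord i \o c : R^o -> R^o) t); last by [].
rewrite derive_comp//; last exact: differentiable_fiber_coord.
by have [_ ->] := is_derive_fiber_coord i (c t) ('D_1 c t).
Qed.

Lemma lift_derive (f : M * E -> R) t : smooth_fun TA slit f -> D t ->
  is_derive t 1 (f \o h : R^o -> R^o) (dfun TA f (h t) (V t) : R^o).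
Proof.
move=> sf Dt; apply: (derive_along_curve sh Dt).
- exact: tangent_unchart_at.
- by move=> a xi axi; exact: (tangent_unchartK hM axi).
- by apply: slit_fun_differentiable => //; exact: (Sigma_slit hF (lift_Sigma Dt)).
Qed.

(** [D] is open, so the norm is constantly 1 along the lift near [t] and its derivative vanishes. *)
Lemma lift_tangent t : D t -> tangent_Sigma A F (h t) (V t).
Proof.
move=> Dt; have [_ sF _ _] := hF; have [_ e] := lift_derive sF Dt.
rewrite /tangent_Sigma -[LHS]e -(derive_cst (1 : R^o) (t : R^o) (1 : R^o)).
by apply: near_eq_derive; apply: (open_near hDopen Dt) => r /lift_Sigma.
Qed.

Lemma lift_omega2 t : D t -> omega2 A F (h t) (V t) = 0.
Proof.
move=> Dt; have [_ _ _ _ NT] := hN.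
have := NT t Dt; rewrite g_inner_self ?lift_neq0//.
rewrite -[F _]/(F (h t)) (lift_Sigma Dt) mul1r => e; rewrite -[RHS]e /omega2.
by rewrite lift_velocity1.
Qed.

(** If [omega1] vanished, the velocity would be proportional to [N] as well as orthogonal to it,
    hence zero, while its norm is 1. *)
Lemma lift_omega1 t : D t -> omega1 A F (h t) (V t) != 0.
Proof.
move=> Dt; have [_ FT _ NN NT] := hN.
apply/eqP => e.
have T0 : velocity A gamma t = 0; last first.
  by have := FT t Dt; rewrite T0 (finsler_zero hF) => /eqP; rewrite eq_sym oner_eq0.
have nz : Num.sqrt (\det (g_mx F (chart_at A (gamma t))
    (chart_map (c := TA) (chart_at A (gamma t)) (h t)))) / F (h t) != 0.
  rewrite (lift_Sigma Dt) divr1 sqrtr_eq0 -ltNge.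
  exact: (det_g_gt0 hM hF (gamma t) (lift_neq0 Dt)).
move/eqP: e; rewrite /omega1 mulf_eq0 (negPf nz) /= (vec_coord_id hA) lift_velocity1//.
rewrite subr_eq0 => /eqP e.
(* Without division: proportionality gives [T i * g(y, y) = y i * g(y, T)], where [g(y, y) = 1] and
   [g(y, T) = 0]. *)
have alg (G : 'I_2 -> 'I_2 -> R) (y T : 'I_2 -> R) : y 1 * T 0 = y 0 * T 1 ->
    \sum_i \sum_j G i j * y i * y j = 1 -> \sum_i \sum_j G i j * y i * T j = 0 ->
    forall i, T i = 0.
  move=> ye; rewrite !sum2E => e1 e2; elim/ord2P; rewrite -[LHS]mulr1 -e1.
    transitivity (y 0 * (G 0 0 * y 0 * T 0 + G 0 1 * y 0 * T 1 + (G 1 0 * y 1 * T 0 + G 1 1 * y 1 * T 1))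
      + (G 0 1 * y 0 + G 1 1 * y 1) * (y 1 * T 0 - y 0 * T 1)); first by ring.
    by rewrite e2 ye subrr !mulr0 addr0.
  transitivity (y 1 * (G 0 0 * y 0 * T 0 + G 0 1 * y 0 * T 1 + (G 1 0 * y 1 * T 0 + G 1 1 * y 1 * T 1))
      - (G 0 0 * y 0 + G 1 0 * y 1) * (y 1 * T 0 - y 0 * T 1)); first by ring.
  by rewrite e2 ye subrr !mulr0 subr0.
apply/rowP => i; rewrite mxE.
exact: (alg _ _ (velocity A gamma t 0) e (NN t Dt) (NT t Dt) i).
Qed.

End Lift.

(** * The Euler-Lagrange system along the lift *)

Section ShiftedCurve.
Context {R : realType} {E : normedModType R} {X : Type} (A : charts E X).

Lemma smooth_curve_shift (D : set R) (c : R -> X) t e : smooth_curve A D c ->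
  (forall s, `]- e, e[%classic s -> D (s + t)) ->
  smooth_curve A `]- e, e[ (fun s => c (s + t)).
Proof.
move=> sc eD a; have [oD sm] := sc a.
have oI : open (`]- e, e[ `&` (fun s => c (s + t)) @^-1` chart_dom a).
  rewrite (_ : _ `&` _ = `]- e, e[%classic `&`
      ((fun s => s + t) @^-1` (D `&` c @^-1` chart_dom a))); last first.
    apply/seteqP; split=> s [se cs]; split=> //; last by case: cs.
    by split=> //; exact: eD.
  apply: openI; first exact: interval_open.
  apply: open_comp => // s _.
  by apply: continuousD; [exact: cvg_id|exact: cst_continuous].
split=> // k; apply: (Ck_on_shift (V := R^o) (f := chart_map a \o c) oI _ (sm k)).
by move=> s [se cs]; split=> //; exact: eD.
Qed.

Lemma velocity_shift (c : R -> X) t : velocity A (fun s => c (s + t)) 0 = velocity A c t.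
Proof.
rewrite /velocity add0r /derive1; apply: (congr1 (fun d : R -> E => lim (d @ 0^'))).
by apply/funext => s /=; rewrite addr0 add0r.
Qed.

End ShiftedCurve.

Section EulerLagrange.
Context {R : realType} {M : topologicalType} {A : charts 'rV[R]_2 M}.
Context (hM : oriented_surface A) {F : M * 'rV[R]_2 -> R} (hF : finsler_metric A F).
Notation E := 'rV[R]_2.
Notation TA := (tangent_charts A).
Notation ZA := (line_charts TA).
Let hA := oriented_smooth_atlas hM.
Context {D : set R} (hDopen : open D).
Context {gamma : R -> M} {N : R -> E} (hN : normal_lift A F D gamma N).
Context {omega3 : M * E -> E * E -> R} {cI cJ cK : M * E -> R}.
Context (hstr : structure_equations A F omega3 cI cJ cK).
Let h := field_lift gamma N.
Let V t := velocity TA h t.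

Lemma line_velocity (c : R -> (M * E) * R) t : D t -> (forall r, D r -> (c r).1 = h r) ->
  derivable (fun r => (c r).2 : R^o) (t : R^o) 1 ->
  velocity ZA c t = (V t, 'D_1 ((fun r => (c r).2) : R^o -> R^o) t).
Proof.
move=> Dt ch dc; pose a : chart_index A := chart_at A (gamma t).
have [_ _ sh _ _] := hN.
have dh : differentiable (chart_map (c := TA) a \o h : R^o -> (E * E)%type) t.
  by apply: (smooth_curve_differentiable sh Dt); exact: (chart_at_dom hA).
have d := is_derive_pair (diff_is_derive (1 : R^o) dh) (derivableP dc).
have e : \forall r \near (t : R^o),
    ((chart_map (c := TA) a \o h) r, (c r).2 : R^o) = (chart_map (c := ZA) a \o c) r.
  by apply: (open_near hDopen Dt) => r Dr /=; rewrite ch.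
have [_ e2] := near_eq_is_derive e d.
have -> : velocity ZA c t = 'D_1 (chart_map (c := ZA) a \o c : R^o -> (E * E * R^o)%type) t.
  by rewrite velocityE /= ch.
by rewrite e2 /V velocityE.
Qed.

Lemma Ck_scalar_comp k (U : set R) (W : set (E * E)) (c : R -> E * E) (f : E * E -> R) :
  open U -> (forall t, U t -> W (c t)) ->
  Ck_on k (U : set R^o) (c : R^o -> (E * E)%type) -> Ck_on k W (f : _ -> R^o) ->
  Ck_on k (U : set R^o) ((fun t => f (c t)) : R^o -> R^o).
Proof.
pose b (i : 'I_2 + 'I_2) : E * E := match i with inl i => (evec i, 0) | inr i => (0, evec i) end.
pose l (i : 'I_2 + 'I_2) : {linear (E * E)%type -> R^o} :=
  match i with inl i => @base_coord R i | inr i => @fiber_coord R i end.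
move=> oU cU; apply: (Ck_on_comp (b := b) (l := l) (V := R^o)) => //.
- by move=> v; rewrite {1}(pair_coordE v) big_sumType.
- by move=> [i|i]; [exact: base_coord_continuous|exact: fiber_coord_continuous].
Qed.

(** The condition [lambda = - I] on integral elements leaves this as the only candidate lift to
    Z. *)
Let cc t : (M * E) * R := (h t, - cI (h t)).

Lemma lift_line_smooth : smooth_curve ZA D cc.
Proof.
have [_ [sI _ _] _ _] := hstr; have [_ _ sh _ _] := hN.
move=> a; have [oD sm] := sh a; split; first exact: oD.
move=> k; apply: (Ck_on_pair (V := R^o)) => //.
have cU t : (D `&` h @^-1` chart_dom (c := TA) a) t ->
    slit_image a (chart_map (c := TA) a (h t)).
  move=> [Dt at_]; apply: slit_image_chart_map => //.
  exact: (Sigma_slit hF (lift_Sigma hM hF hN Dt)).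
have C1 := Ck_scalar_comp oD cU (sm k) (sI a k).
apply: Ck_on_ext (Ck_onM (V := R^o) oD (Ck_on_cst (V := R^o) k _ (-1 : R^o)) C1) => //.
move=> t [Dt at_] /=; rewrite mulN1r; congr (- cI _).
exact: (tangent_unchartK hM (xi := h t) at_).
Qed.

Let IV t := dfun TA cI (h t) (V t).

Lemma lift_line_velocity t : D t -> velocity ZA cc t = (V t, - IV t).
Proof.
move=> Dt; have [_ [sI _ _] _ _] := hstr.
have d := is_deriveN (lift_derive hM hF hN sI Dt).
have [c e] := d.
by rewrite (line_velocity Dt) //; congr (_, _).
Qed.

Lemma lift_line_integral t : D t -> IV t + omega3 (h t) (V t) = 0 ->
  integral_element A F (cc t) (velocity ZA cc t).
Proof.
move=> Dt e; rewrite lift_line_velocity//.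
apply/(integral_elementP hM hF (lift_Sigma hM hF hN Dt) hstr).
  exact: (lift_tangent hM hF hDopen hN Dt).
split=> //=; first exact/eqP/(lift_omega1 hM hF hN Dt).
  exact: (lift_omega2 hM hF hN Dt).
by move: e; lra.
Qed.

(* The curve itself, with its parameter translated, witnesses tangency to every
   stage of the construction. *)
Lemma lift_line_Ziter n : (forall t, D t -> IV t + omega3 (h t) (V t) = 0) ->
  forall t, D t -> Ziter A F n (cc t).
Proof.
move=> e; elim: n => [|n IH] t Dt /=; first exact: (lift_Sigma hM hF hN Dt).
split; first exact: IH.
exists (velocity ZA cc t); last by apply: lift_line_integral => //; exact: e.
have /nbhs_ballP[r /= r0 rD] := open_nbhs_nbhs (conj hDopen Dt).
have rD' s : `]- r, r[%classic s -> D (s + t).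
  rewrite /= in_itv /= => /andP[s1 s2]; apply: rD.
  by rewrite /ball /= opprD addrCA subrr addr0 normrN ltr_norml s1 s2.
exists r, (fun s => cc (s + t)); split.
- exact: r0.
- exact: smooth_curve_shift lift_line_smooth rD'.
- by move=> s /rD'; exact: IH.
- by rewrite add0r.
- exact: velocity_shift.
Qed.

(** From left to right, [lambda = - I] holds at every parameter of the open set [D] and can be
    differentiated along the curve; the derivative of [lambda] is also the value of [omega3]. From
    right to left, [cc] is the integral curve. *)
Lemma satisfies_EL_lift : satisfies_EL A F D h <->
  forall t, D t -> IV t + omega3 (h t) (V t) = 0.
Proof.
have [_ [sI _ _] _ _] := hstr.
split=> [[c [sc ic] ch] t Dt|e]; last first.
  exists cc => //; split; first exact: lift_line_smooth.
  by move=> t Dt; split; [move=> n _; exact: lift_line_Ziter|apply: lift_line_integral => //; exact: e].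
have dc r : D r -> derivable (fun r => (c r).2 : R^o) (r : R^o) 1.
  move=> Dr.
  have cr : chart_dom (chart_at ZA (c r)) (c r).
    by rewrite /= ch//; exact: (chart_at_dom hA).
  have ds := smooth_curve_differentiable sc Dr cr.
  have d2 := differentiable_comp ds (differentiable_snd _).
  by have [] := diff_is_derive (1 : R^o) d2.
have P r : D r -> (c r).2 = - cI (h r)
    /\ omega3 (h r) (V r) = 'D_1 ((fun r => (c r).2) : R^o -> R^o) r.
  move=> Dr; have [_] := ic r Dr; rewrite (line_velocity Dr ch (dc r Dr)).
  rewrite {1}(surjective_pairing (c r)) ch// => ie.
  pose v : (E * E) * R^o := (V r, 'D_1 ((fun r => (c r).2) : R^o -> R^o) r).
  have tv : tangent_Sigma A F (h r) v.1 by exact: (lift_tangent hM hF hDopen hN Dr).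
  have [_ l1 _ l3] := (integral_elementP hM hF (lift_Sigma hM hF hN Dr) hstr (c r).2 tv).1 ie.
  by split; [exact: l1|exact: l3].
have [_ ->] := P t Dt.
have [_ e] := is_deriveN (lift_derive hM hF hN sI Dt).
have -> : 'D_1 ((fun r => (c r).2) : R^o -> R^o) t = - IV t; last by rewrite subrr.
rewrite -[RHS]e; apply: near_eq_derive.
by apply: (open_near hDopen Dt) => r /P[].
Qed.

Context {I1 I2 I3 : M * E -> R} (hI : coframe_derivatives A F omega3 cI I1 I2 I3).
Context {k : R -> R} (hk : parallel_curvature A F D gamma N k).

Lemma lift_omega3 t : D t -> omega3 (h t) (V t) = - k t / sigma_along A F gamma N t.
Proof.
move=> Dt; have Sh := lift_Sigma hM hF hN Dt.
have s0 := lift_omega1 hM hF hN Dt.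
rewrite (omega3_coord hM hF Sh hstr (lift_tangent hM hF hDopen hN Dt) s0
  (lift_omega2 hM hF hN Dt)).
set a := chart_at A (h t).1; set z := chart_map (c := TA) a (h t).
have az : slit_image a z.
  by apply: slit_image_chart_map; [exact: (chart_at_dom hA)|exact: (Sigma_slit hF Sh)].
have zN : z.2 = N t by exact: (vec_coord_id hA).
have alg (b c d : R) : b * c * d = d * c * b by ring.
(* The Chern coefficients are evaluated at [N] and contracted with [N], so [chern_y] collapses them
   to the nonlinear connection applied to the velocity. *)
have -> : \row_i ((V t).2 0 i + \sum_j nonlinear_connection F a z i j * (V t).1 0 j)
    = cov_deriv A F gamma N N t.
  apply/rowP => i; rewrite !mxE -(lift_velocity2 hM hN i Dt); congr (_ + _).
  apply: eq_bigr => j _; rewrite (lift_velocity1 hM hN Dt) -(chern_y hA hF az i j) zN.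
  by rewrite mulr_suml; apply: eq_bigr => m _; exact: alg.
rewrite hk//.
have sE : sigma_along A F gamma N t = coord_omega1 F a (V t) z.
  exact: (omega1_coord hM Sh).
have : coord_omega1 F a (- (k t / sigma_along A F gamma N t ^+ 2) *: velocity A gamma t, 0) z
    = - (k t / sigma_along A F gamma N t ^+ 2) * coord_omega1 F a (V t) z.
  by apply: coord_omega1Z; rewrite /= (lift_velocity1 hM hN Dt).
rewrite -sE => ->.
have s0' : sigma_along A F gamma N t != 0 by exact: s0.
by field.
Qed.

Lemma lift_EL_equation t : D t -> (IV t + omega3 (h t) (V t) = 0 <->
  (I3 (h t) + 1) * k t = I1 (h t) * sigma_along A F gamma N t ^+ 2).
Proof.
move=> Dt; have Sh := lift_Sigma hM hF hN Dt.
rewrite /IV (hI Sh (lift_tangent hM hF hDopen hN Dt)) (lift_omega2 hM hF hN Dt) mulr0 addr0.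
rewrite lift_omega3// -[omega1 _ _ _ _]/(sigma_along A F gamma N t).
have s0 : sigma_along A F gamma N t != 0 by exact: (lift_omega1 hM hF hN Dt).
move: (sigma_along _ _ _ _ _) s0 => s s0.
(* With the [omega2] component gone, the one-form evaluated on the velocity is the difference of the
   two sides of the equation divided by the nonzero [s]. *)
have -> : I1 (h t) * s + I3 (h t) * (- k t / s) + - k t / s
    = (I1 (h t) * s ^+ 2 - (I3 (h t) + 1) * k t) / s by field.
split=> [/eqP|->]; last by rewrite subrr mul0r.
by rewrite mulf_eq0 invr_eq0 (negPf s0) orbF subr_eq0 => /eqP.
Qed.

End EulerLagrange.

Theorem theorem5p2 (R : realType) (M : topologicalType)
    (A : charts 'rV[R]_2 M) (hM : oriented_surface A)
    (F : M * 'rV[R]_2 -> R) (hF : finsler_metric A F)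
    (omega3 : M * 'rV[R]_2 -> 'rV[R]_2 * 'rV[R]_2 -> R)
    (cI cJ cK : M * 'rV[R]_2 -> R)
    (hstr : structure_equations A F omega3 cI cJ cK)
    (I1 I2 I3 : M * 'rV[R]_2 -> R)
    (hI : coframe_derivatives A F omega3 cI I1 I2 I3)
    (D : set R) (hDopen : open D) (hDint : is_interval D)
    (gamma : R -> M) (N : R -> 'rV[R]_2) (hN : normal_lift A F D gamma N)
    (k : R -> R) (hk : parallel_curvature A F D gamma N k) :
  (satisfies_EL A F D (field_lift gamma N) <->
     forall t, D t ->
       let v := velocity (tangent_charts A) (field_lift gamma N) t in
       dfun (tangent_charts A) cI (field_lift gamma N t) v
       + omega3 (field_lift gamma N t) v = 0)
  /\
  (satisfies_EL A F D (field_lift gamma N) <->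
     forall t, D t ->
       (I3 (field_lift gamma N t) + 1) * k t
       = I1 (field_lift gamma N t) * sigma_along A F gamma N t ^+ 2).
Proof.
have EL := satisfies_EL_lift hM hF hDopen hN hstr.
split; first exact: EL.
apply: (iff_trans EL); split=> e t Dt.
  exact/(lift_EL_equation hM hF hDopen hN hstr hI hk Dt)/e.
exact/(lift_EL_equation hM hF hDopen hN hstr hI hk Dt)/e.
Qed.
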